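(* Let $\{A_n\}_{n\ge1}$ be a sequence of Hermitian matrices such that $A_n\in\mathbf{M}_n(\mathbb{C})$ and $\mathrm{Tr}(A_n)=0$. Assume that $$\frac{(\log n)\,\|A_n\|}{n^{1/2}}\xrightarrow[n\to\infty]{}0\qquad\text{and}\qquad\frac1n\,\mathrm{Tr}(A_n^2)\xrightarrow[n\to\infty]{}\sigma^2>0 .$$ Then the rescaled numerical measure $\mu_{\sqrt n A_n}$ converges weakly to the normal distribution $\mathcal{N}(0,\sigma^2)$ as $n\to\infty$.
   Context: $\|A\|=\sup\{\|Ax\|:x\in\mathbb{C}^n,\|x\|=1\}$ is the operator norm. The numerical measure $\mu_A$ of $A\in\mathbf{M}_n(\mathbb{C})$ is the image, under $x\mapsto\langle Ax,x\rangle$ (with $\langle x,y\rangle=y^*x$), of the normalized (probability) Euclidean surface measure on the unit sphere of $\mathbb{C}^n$; for Hermitian $A$ it is regarded as a probability measure on $\mathbb{R}$. $\mathcal{N}(0,\sigma^2)$ is the centered Gaussian law on $\mathbb{R}$ with variance $\sigma^2$. Weak convergence is that of probability measures. *)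

(* Defs.v *)
From HB Require Import structures.
From mathcomp Require Import all_boot all_order all_algebra.
From mathcomp Require Import all_classical all_reals all_analysis.
From mathcomp Require Import measurable_realfun complex.

Set Implicit Arguments.
Unset Strict Implicit.
Unset Printing Implicit Defensive.

Import Order.TTheory GRing.Theory Num.Theory.
Import numFieldNormedType.Exports.

Local Open Scope classical_set_scope.
Local Open Scope ring_scope.
Local Open Scope sesquilinear_scope.

Section tuple_cons.
Context d (T : measurableType d) (n : nat).

Definition tuple_cons (p : T * n.-tuple T) : n.+1.-tuple T :=
  [the n.+1.-tuple T of p.1 :: p.2].

Definition tuple_uncons (t : n.+1.-tuple T) : T * n.-tuple T :=
  (thead t, [tuple of behead t]).

Lemma tuple_consK : cancel tuple_cons tuple_uncons.
Proof.
move=> [x t]; rewrite /tuple_cons /tuple_uncons /=; congr (_, _).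
exact: val_inj.
Qed.

Lemma tuple_unconsK : cancel tuple_uncons tuple_cons.
Proof. by move=> t; rewrite /tuple_cons /= [RHS]tuple_eta; exact: val_inj. Qed.

Lemma measurable_tuple_cons : measurable_fun setT tuple_cons.
Proof. exact: measurable_cons. Qed.

Lemma measurable_tuple_uncons : measurable_fun setT tuple_uncons.
Proof.
apply: measurable_fun_pair; first exact: measurable_tnth.
exact: measurable_behead.
Qed.

End tuple_cons.

Section cons_measure.
Context d (T : measurableType d) (R : realType) (n : nat).
Variable mu : {sigma_finite_measure set T -> \bar R}.
Variable nu : {sigma_finite_measure set (n.-tuple T) -> \bar R}.

Definition cons_measure : set (n.+1.-tuple T) -> \bar R :=
  pushforward (mu \x nu)%E (@tuple_cons _ T n).

Let cons_measure0 : cons_measure set0 = 0%E.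
Proof. by rewrite /cons_measure /pushforward preimage_set0 measure0. Qed.

Let cons_measure_ge0 A : (0 <= cons_measure A)%E.
Proof. by rewrite /cons_measure /pushforward measure_ge0. Qed.

Let cons_measure_sigma_additive : semi_sigma_additive cons_measure.
Proof.
have := @measure_semi_sigma_additive _ _ _
  (pushforward [the {measure set _ -> \bar R} of (mu \x nu)%E] (@tuple_cons _ T n)).
apply; exact: measurable_tuple_cons.
Qed.

HB.instance Definition _ := isMeasure.Build _ _ _ cons_measure
  cons_measure0 cons_measure_ge0 cons_measure_sigma_additive.

Let cons_measure_sigma_finite : sigma_finite setT cons_measure.
Proof.
have /sigma_finiteP[F [TF ndF Foo]] := sigma_finiteT mu.
have /sigma_finiteP[G [TG ndG Goo]] := sigma_finiteT nu.
exists (fun k => @tuple_uncons _ T n @^-1` (F k `*` G k)).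
  rewrite -preimage_bigcup; apply/seteqP; split => // t _ /=.
  have : setT (tuple_uncons t).1 by [].
  have : setT (tuple_uncons t).2 by [].
  rewrite {1}TG {1}TF => -[k _ Gk] [l _ Fl]; exists (maxn k l) => //; split.
    by move: Fl; exact/subsetPset/ndF/leq_maxr.
  by move: Gk; exact/subsetPset/ndG/leq_maxl.
move=> k; have [mF Fk] := Foo k; have [mG Gk] := Goo k; split.
  rewrite -[X in measurable X]setTI; apply: measurable_tuple_uncons => //.
  exact: measurableX.
rewrite /cons_measure /pushforward -comp_preimage.
rewrite (_ : _ \o _ = id) ?preimage_id; last exact/funext/tuple_consK.
by rewrite product_measure1E// lte_mul_pinfty// ge0_fin_numE.
Qed.

HB.instance Definition _ := Measure_isSigmaFinite.Build _ _ _ cons_measure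
  cons_measure_sigma_finite.

End cons_measure.


(* The n-fold product measure of mu. *)
Fixpoint power_measure d (T : measurableType d) (R : realType)
    (mu : {sigma_finite_measure set T -> \bar R}) (n : nat) :
    {sigma_finite_measure set (n.-tuple T) -> \bar R} :=
  match n return {sigma_finite_measure set (n.-tuple T) -> \bar R} with
  | 0 => @dirac _ (0.-tuple T) [tuple] R
  | n'.+1 => cons_measure mu (power_measure mu n')
  end.

Lemma measurable_cube d (T : measurableType d) (n : nat) (A : set T) :
  measurable A -> measurable [set t : n.-tuple T | forall i, A (tnth t i)].
Proof.
move=> mA; rewrite (_ : [set _ | _] =
    \bigcap_(i in [set: 'I_n]) (@tnth n T ^~ i @^-1` A)).
  apply: fin_bigcap_measurable => [|i _]; first exact: finite_finset.
  by rewrite -[X in measurable X]setTI; exact: measurable_tnth.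
by apply/seteqP; split => t /= h i; [move=> _|]; exact: h.
Qed.

Lemma power_measure_cube d (T : measurableType d) (R : realType)
    (mu : {sigma_finite_measure set T -> \bar R}) (n : nat) (A : set T) :
  measurable A ->
  power_measure mu n [set t | forall i, A (tnth t i)] = (mu A ^+ n)%E.
Proof.
move=> mA; elim: n => [|n IHn] /=.
  by rewrite diracE mem_set//; move=> [].
rewrite /cons_measure /pushforward.
rewrite (_ : _ @^-1` _ =
    A `*` [set t : n.-tuple T | forall i, A (tnth t i)]); last first.
  apply/seteqP; split => -[x t] /=.
    move=> h; split; first exact: (h ord0).
    by move=> i; have := h (lift ord0 i); rewrite !(tnth_nth x).
  move=> [Ax At] i; have [->//|[j ->]] : i = ord0 \/ exists j, i = lift ord0 j.
    by case: (unliftP ord0 i) => [j ->|->]; [right; exists j|left].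
  by have := At j; rewrite !(tnth_nth x).
rewrite product_measure1E//; last exact: measurable_cube.
by rewrite IHn; case: (n) => [|m] /=; rewrite ?mule1.
Qed.

Section euclidean_sphere.
Context {R : realType}.
Local Notation RT := (measurableTypeR R).

Definition lebesgue_tuple (n : nat) :
    {sigma_finite_measure set (n.-tuple RT) -> \bar R} :=
  power_measure (@lebesgue_measure R) n.

Definition enorm n (t : n.-tuple RT) : R := Num.sqrt (\sum_i tnth t i ^+ 2).

Definition normalize n (t : n.-tuple RT) : n.-tuple RT :=
  [tuple (tnth t i / enorm t : RT) | i < n].

Definition punctured_ball n : set (n.-tuple RT) := [set t | 0 < enorm t <= 1].

Lemma measurable_enorm n : measurable_fun setT (@enorm n).
Proof.
apply: (@measurableT_comp _ _ _ _ _ _ (@Num.sqrt R)).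
  by apply: continuous_measurable_fun; exact: sqrt_continuous.
apply: measurable_sum => i; apply: measurable_funX; exact: measurable_tnth.
Qed.

Lemma measurable_normalize n : measurable_fun setT (@normalize n).
Proof.
apply/measurable_fun_tnthP => i.
rewrite (_ : _ \o _ =
    fun t : n.-tuple RT => tnth t i * enorm t `^ (-1)); last first.
  by apply/funext => t /=; rewrite tnth_mktuple powR_inv1 ?sqrtr_ge0.
apply: measurable_funM; first exact: measurable_tnth.
apply: (@measurableT_comp _ _ _ _ _ _ (@powR R ^~ (-1))).
  exact: measurable_powR.
exact: measurable_enorm.
Qed.

Lemma measurable_punctured_ball n : measurable (@punctured_ball n).
Proof.
rewrite (_ : @punctured_ball n = @enorm n @^-1` `]0, 1]).
  by rewrite -[X in measurable X]setTI; apply: measurable_enorm.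
by apply/seteqP; split => t /=; rewrite in_itv.
Qed.

(* Euclidean surface measure of the unit sphere of R^n, as a measure on R^n
   carried by the sphere, defined by polar coordinates:
     sigma(E) = n * lambda {x | 0 < |x| <= 1, x / |x| \in E}
   (Folland, Real Analysis, Theorem 2.49). *)
Definition surface_measure n (E : set (n.-tuple RT)) : \bar R :=
  (n%:R%:E * lebesgue_tuple n (@normalize n @^-1` E `&` @punctured_ball n))%E.

Section surface_measure_is_measure.
Variable n : nat.
Let surface0 : @surface_measure n set0 = 0%E.
Proof. by rewrite /surface_measure preimage_set0 set0I measure0 mule0. Qed.

Let surface_ge0 A : (0 <= @surface_measure n A)%E.
Proof. by rewrite /surface_measure mule_ge0 ?measure_ge0. Qed.

Let surface_sigma_additive : semi_sigma_additive (@surface_measure n).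
Proof.
have mnu := @measurable_normalize n.
pose nu := pushforward (mrestr (lebesgue_tuple n) (@measurable_punctured_ball n))
  (@normalize n).
have nu_sadd : semi_sigma_additive nu by exact: measure_semi_sigma_additive.
move=> F mF tF mUF; have := nu_sadd F mF tF mUF.
have fn : (n%:R%:E : \bar R)%E \is a fin_num by [].
move=> /(cvgeZl fn).
rewrite [X in X @ _ --> _](_ : _ =
  fun k => (\sum_(0 <= i < k) surface_measure (F i))%E)//.
apply/funext => k /=; rewrite ge0_sume_distrr// => i _.
by rewrite /nu /pushforward /mrestr measure_ge0.
Qed.

HB.instance Definition _ := isMeasure.Build _ _ _ (@surface_measure n)
  surface0 surface_ge0 surface_sigma_additive.
End surface_measure_is_measure.

Lemma surface_measure_sphere n :
  @surface_measure n [set t | enorm t != 1] = 0%E.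
Proof.
rewrite /surface_measure (_ : _ `&` _ = set0) ?measure0 ?mule0//.
rewrite -subset0 => t [/= + /andP[t0 _]]; rewrite /normalize /enorm.
under eq_bigr do rewrite tnth_mktuple exprMn.
rewrite -mulr_suml sqrtrM ?sumr_ge0// => [|i _]; last exact: sqr_ge0.
by rewrite sqrtr_sqr normfV ger0_norm ?sqrtr_ge0// divff ?eqxx ?gt_eqF.
Qed.

Lemma surface_measure_lty n : (@surface_measure n setT < +oo)%E.
Proof.
rewrite /surface_measure preimage_setT setTI lte_mul_pinfty//.
pose A : set RT := `[-1, 1]%classic.
have mA : measurable A by exact: measurable_itv.
apply: (@le_lt_trans _ _ (lebesgue_tuple n [set t | forall i, A (tnth t i)])).
  apply: le_measure; rewrite ?inE.
  - exact: measurable_punctured_ball.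
  - exact: measurable_cube.
  - move=> t /andP[_ t1] i; rewrite /A /= in_itv/= -ler_norml.
    apply: le_trans t1; rewrite -sqrtr_sqr ler_sqrt; last first.
      by apply: sumr_ge0 => j _; exact: sqr_ge0.
    by rewrite (bigD1 i)//= lerDl sumr_ge0// => j _; exact: sqr_ge0.
have [l lA] : exists l : R, lebesgue_measure A = l%:E.
  by exists (1 - -1); rewrite /A lebesgue_measure_itv/= lte_fin ifT// gtrN.
by rewrite /lebesgue_tuple power_measure_cube// [X in (X ^+ _)%E]lA -EFin_expe ltry.
Qed.

Lemma surface_measure_gt0 n : (0 < @surface_measure n.+1 setT)%E.
Proof.
rewrite /surface_measure preimage_setT setTI mule_gt0//.
pose c : R := n.+1%:R^-1.
have c0 : 0 < c by rewrite invr_gt0.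
have c1 : c <= 1 by rewrite invf_le1// ler1n.
pose A : set RT := `[c / 2, c]%classic.
have mA : measurable A by exact: measurable_itv.
apply: (@lt_le_trans _ _
    (lebesgue_tuple n.+1 [set t | forall i, A (tnth t i)])).
  have c2 : c / 2 < c by rewrite gtr_pMr// invf_lt1 ?ltr1n.
  have lA : lebesgue_measure A = (c - c / 2)%:E.
    by rewrite /A lebesgue_measure_itv/= lte_fin c2.
  rewrite /lebesgue_tuple power_measure_cube// [X in (X ^+ _)%E]lA -EFin_expe.
  by rewrite lte_fin exprn_gt0// subr_gt0.
apply: le_measure; rewrite ?inE.
- exact: measurable_cube.
- exact: measurable_punctured_ball.
- move=> t /= At; have tA i : c / 2 <= tnth t i <= c.
    by have := At i; rewrite /A /= in_itv.
  apply/andP; split.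
    rewrite sqrtr_gt0 (bigD1 ord0)//= ltr_wpDr ?sumr_ge0//.
      by move=> i _; exact: sqr_ge0.
    rewrite exprn_gt0//; have /andP[+ _] := tA ord0.
    by apply: lt_le_trans; rewrite divr_gt0.
  rewrite -sqrtr1 ler_sqrt//.
  apply: (@le_trans _ _ (\sum_(i < n.+1) c)).
    apply: ler_sum => i _; have /andP[ti0 tic] := tA i.
    have t0 : 0 <= tnth t i by apply: le_trans ti0; rewrite divr_ge0 ?ltW.
    rewrite expr2 (le_trans (ler_pM _ _ tic tic))//.
    by rewrite ler_piMl// ltW.
  by rewrite sumr_const card_ord -mulr_natr mulVf.
Qed.

(* The Dirac mass is only the default value required by mnormalize; it is not
   used for n > 0, by surface_measure_gt0 and surface_measure_lty. *)
Definition sphere_uniform n : probability (n.-tuple RT) R :=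
  mnormalize (@surface_measure n)
    (@dirac _ (n.-tuple RT) [tuple (0 : RT) | i < n] R).

End euclidean_sphere.

Section numerical_measure.
Context {R : realType}.
Local Notation RT := (measurableTypeR R).

(* <x, y> = y^* x *)
Definition inner n (x y : 'cV[R[i]]_n) : R[i] := (y ^t* *m x) 0 0.

Definition cnorm n (x : 'cV[R[i]]_n) : R := Num.sqrt (complex.Re (inner x x)).

Definition opnorm n (A : 'M[R[i]]_n) : R :=
  sup [set cnorm (A *m x) | x in [set x : 'cV[R[i]]_n | cnorm x = 1]].

(* C^n is identified with R^(n + n): the first n coordinates are the real
   parts, the last n the imaginary parts. *)
Definition cvec n (t : (n + n).-tuple RT) : 'cV[R[i]]_n :=
  \col_k Complex (tnth t (lshift n k) : R) (tnth t (rshift n k) : R).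

Lemma cnorm_cvec n (t : (n + n).-tuple RT) : cnorm (cvec t) = enorm t.
Proof.
rewrite /cnorm /enorm /inner !mxE raddf_sum/= big_split_ord/= -big_split/=.
congr Num.sqrt; apply: eq_bigr => k _.
by rewrite !mxE /= !expr2 mulNr opprK.
Qed.

(* <Ax, x> is real when A is Hermitian. *)
Definition numerical_fun n (A : 'M[R[i]]_n) (t : (n + n).-tuple RT) : RT :=
  complex.Re (inner (A *m cvec t) (cvec t)).

Lemma measurable_numerical_fun n (A : 'M[R[i]]_n) :
  measurable_fun setT (numerical_fun A).
Proof.
rewrite (_ : numerical_fun A = fun t => \sum_k \sum_j
   (tnth t (lshift n k) * (complex.Re (A k j) * tnth t (lshift n j) -
      complex.Im (A k j) * tnth t (rshift n j)) +
    tnth t (rshift n k) * (complex.Re (A k j) * tnth t (rshift n j) +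
      complex.Im (A k j) * tnth t (lshift n j)))); last first.
  apply/funext => t; rewrite /numerical_fun /inner !mxE raddf_sum/=.
  apply: eq_bigr => k _; rewrite !mxE big_distrr raddf_sum/=.
  apply: eq_bigr => j _; rewrite !mxE.
  by case: (A k j) => a b /=; rewrite mulNr opprK.
apply: measurable_sum => k; apply: measurable_sum => j.
apply: measurable_funD; apply: measurable_funM; try exact: measurable_tnth.
  apply: measurable_funB; apply: measurable_funM => //; exact: measurable_tnth.
apply: measurable_funD; apply: measurable_funM => //; exact: measurable_tnth.
Qed.

HB.instance Definition _ n (A : 'M[R[i]]_n) :=
  isMeasurableFun.Build _ _ _ _ (@numerical_fun n A)
    (measurable_numerical_fun A).

(* The numerical measure of a Hermitian matrix A, as a measure on R. For
   non-Hermitian A this is only the real marginal of the numerical measure. *)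
Definition numerical_measure n (A : 'M[R[i]]_n) : probability RT R :=
  distribution (@sphere_uniform R (n + n)) (numerical_fun A).

End numerical_measure.

Definition weak_cvg (R : realType)
    (mu_ : nat -> probability (measurableTypeR R) R)
    (mu : probability (measurableTypeR R) R) : Prop :=
  forall f : R -> R, continuous f -> bounded_fun f ->
    (\int[mu_ n]_x (f x)%:E)%E @[n --> \oo] --> (\int[mu]_x (f x)%:E)%E.

(* Main.v *)
(* Let [G] be a standard Gaussian vector of R^N, N = 2n, and let [B] be the real symmetric
   matrix of [x |-> A x]. Since [G/|G|] is uniform on the sphere, the numerical measure of
   [sqrt n A] is the law of [sqrt n <B G, G> / |G|^2].  Gaussian integration by parts gives,
   for [W := sqrt n <B G, G> / N] and [tr B = 0],
     E[W f(W)] = E[|B G|^2 f'(W)] / N,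
   and [|B G|^2 / N] concentrates around [tr B^2 / N = tr A^2 / n], because its variance is
   [2 tr B^4 / N^2 <= 2 (||A||^2 / N) (tr B^2 / N)].  Choosing for [f] the solution of Stein's
   equation [s^2 f' - x f = h - E h(N(0, s^2))], for which [f'] is bounded, yields
   [E h(W) -> E h(N(0, s^2))]; finally [|G|^2 / N] is close to 1, so that [W] can be replaced
   by [W N / |G|^2]. *)

Require Import Defs.
From mathcomp Require Import all_boot all_order all_algebra.
From mathcomp Require Import all_classical all_reals all_analysis.
From mathcomp Require Import measurable_realfun complex.
From mathcomp Require Import ring lra.

Set Implicit Arguments.
Unset Strict Implicit.
Unset Printing Implicit Defensive.

Import Order.TTheory GRing.Theory Num.Theory.
Import numFieldNormedType.Exports.

Local Open Scope classical_set_scope.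
Local Open Scope ring_scope.

(** * The standard normal law on the line *)

(** Uniformity of [G/|G|] is the geometric input. The surface measure is defined through the
    Lebesgue measure of the part of a cone inside the unit ball, so it is enough to compare the
    Gaussian and Lebesgue measures of cones. Cutting the Gaussian density horizontally reduces this
    to the homogeneity of Lebesgue measure on balls, without any integration in polar coordinates.
    The test function is merely bounded and continuous, so the Stein solution [f] is only C^1 with
    bounded derivative. This is exactly what the identity for [W f(W)] consumes, and it gives linear
    growth of [f]; hence Gaussian integrals are handled in a class of polynomially bounded
    functions. Errors are measured by second moments only: [|y| <= eps + y^2/eps] takes the place of
    Cauchy-Schwarz, and a pointwise inequality with two squared error terms takes the place of tail
    probabilities. The mean and variance of a quadratic form, both consequences of integration by
    parts, are then all that has to be computed. *)

Section normal_density.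
Context {R : realType}.
Local Notation RT := (measurableTypeR R).
Local Notation mu := (@lebesgue_measure R).

(** [normal_prob] is by definition the integral of its density, so both functions have the same
    integral over every measurable set. *)
Lemma ae_eq_RN_normal_pdf (m s : R) :
  ae_eq mu setT (Radon_Nikodym_SigmaFinite.f (normal_prob m s) mu)
    (EFin \o normal_pdf m s).
Proof.
have dom := normal_prob_dominates m s.
apply: integral_ae_eq => //.
- exact: Radon_Nikodym_SigmaFinite.f_integrable.
- by apply/measurable_EFinP; exact: measurable_normal_pdf.
- by move=> E _ mE; rewrite -Radon_Nikodym_SigmaFinite.f_integral.
Qed.

Lemma ge0_integral_normal_prob (m s : R) (f : RT -> \bar R) :
  measurable_fun setT f -> (forall x, 0 <= f x)%E ->
  (\int[normal_prob m s]_x f x = \int[mu]_x (f x * (normal_pdf m s x)%:E))%E.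
Proof.
move=> mf f0; have dom := normal_prob_dominates m s.
rewrite -(Radon_Nikodym_SigmaFinite.change_of_variables dom)//.
apply: ae_eq_integral => //.
- apply: emeasurable_funM => //.
  exact: measurable_int (Radon_Nikodym_SigmaFinite.f_integrable dom).
- by apply: emeasurable_funM => //; apply/measurable_EFinP; exact: measurable_normal_pdf.
- by apply: ae_eqe_mul2l; exact: ae_eq_RN_normal_pdf.
Qed.

Lemma integrable_normal_prob (m s : R) (f : RT -> R) :
  measurable_fun setT f ->
  (normal_prob m s).-integrable setT (EFin \o f) <->
  mu.-integrable setT (fun x => (f x * normal_pdf m s x)%:E).
Proof.
move=> mf; split => /integrableP[_ foo]; apply/integrableP; split.
- by apply/measurable_EFinP; apply: measurable_funM => //; exact: measurable_normal_pdf.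
- move: foo; rewrite ge0_integral_normal_prob//; last first.
    by apply: measurableT_comp => //; exact/measurable_EFinP.
  apply: le_lt_trans; rewrite le_eqVlt; apply/orP; left; apply/eqP.
  apply: eq_integral => x _ /=.
  by rewrite normrM (ger0_norm (normal_pdf_ge0 _ _ _)) EFinM.
- exact/measurable_EFinP.
- move: foo; rewrite ge0_integral_normal_prob//; last first.
    by apply: measurableT_comp => //; exact/measurable_EFinP.
  apply: le_lt_trans; rewrite le_eqVlt; apply/orP; left; apply/eqP.
  apply: eq_integral => x _ /=.
  by rewrite normrM (ger0_norm (normal_pdf_ge0 _ _ _)) EFinM.
Qed.

Lemma Rintegral_normal_prob (m s : R) (f : RT -> R) :
  (normal_prob m s).-integrable setT (EFin \o f) ->
  \int[normal_prob m s]_x f x = \int[mu]_x (f x * normal_pdf m s x).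
Proof.
move=> intf; have mf : measurable_fun setT f.
  by apply/measurable_EFinP; exact: measurable_int intf.
rewrite /Rintegral -(Radon_Nikodym_change_of_variables (normal_prob_dominates m s))//.
congr fine; apply: ae_eq_integral => //.
- apply: emeasurable_funM; first exact: measurable_int intf.
  apply: (measurable_int mu).
  by apply: Radon_Nikodym_integrable; exact: normal_prob_dominates.
- by apply/measurable_EFinP; apply: measurable_funM => //; exact: measurable_normal_pdf.
under [X in ae_eq _ _ _ X]eq_fun do rewrite EFinM.
apply: ae_eqe_mul2l.
rewrite Radon_NikodymE//=; first exact: normal_prob_dominates.
move=> abmu; case: cid => /= h [h1 h2 h3].
apply: integral_ae_eq => //=.
- by apply/measurable_EFinP; exact: measurable_normal_pdf.
- by move=> E _ mE; rewrite -h3.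
Qed.

Lemma normal_pdf01E (x : R) : normal_pdf 0 1 x = normal_peak 1 * expR (- (x ^+ 2 / 2)).
Proof.
by rewrite normal_pdfE ?oner_neq0// /normal_fun subr0 expr1n mulNr.
Qed.

Lemma is_derive_normal_pdf (s x : R) : s != 0 ->
  is_derive x 1 (normal_pdf 0 s) (- (x / s ^+ 2) * normal_pdf 0 s x).
Proof.
move=> s0; rewrite normal_pdfE//.
have -> : (fun x : R => normal_peak s * normal_fun 0 s x) =
    (normal_peak s *: (@expR R \o (fun x : R => - (s ^+ 2 *+ 2)^-1 * x ^+ 2))).
  apply/funext => y; rewrite /normal_fun /= subr0 fctE /GRing.scale /=.
  by congr (_ * expR _); rewrite mulNr mulrC mulNr.
apply: is_derive_eq.
rewrite /normal_fun /GRing.scale/= subr0.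
have -> : - x ^+ 2 / (s ^+ 2 *+ 2) = - (s ^+ 2 *+ 2)^-1 * x ^+ 2 by rewrite mulNr mulrC mulNr.
by field.
Qed.

End normal_density.

(** * Polynomial growth against the normal law, and one-dimensional integration by parts *)

Section gaussian_polynomials.
Context {R : realType}.
Local Notation RT := (measurableTypeR R).
Local Notation mu := (@lebesgue_measure R).

Lemma one_sqr_ge1 (x : R) : 1 <= 1 + x ^+ 2.
Proof. by rewrite lerDl sqr_ge0. Qed.

Lemma norm_le_one_sqr (x : R) : `|x| <= 1 + x ^+ 2.
Proof. by rewrite -(real_normK (num_real x)); have := normr_ge0 x; nra. Qed.

(** Half of the exponent absorbs the polynomial: [exp(-x^2/2)] is the square of [exp(-x^2/4)], and
    the remaining factor is, up to a constant, the density of variance 2, which is known to be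
    integrable. *)
Lemma poly_normal_pdf_le k : exists2 c : R, 0 <= c &
  forall x, (1 + x ^+ 2) ^+ k * normal_pdf 0 1 x <= c * normal_pdf 0 (Num.sqrt 2) x.
Proof.
have s0 : Num.sqrt 2 != 0 :> R by rewrite sqrtr_eq0 -ltNge.
have p1 := normal_peak_gt0 (oner_neq0 R).
have p2 := normal_peak_gt0 s0.
exists ((4 * k.+1%:R) ^+ k.+1 * normal_peak 1 / normal_peak (Num.sqrt 2)).
  by rewrite divr_ge0 ?mulr_ge0 ?exprn_ge0 ?mulr_ge0// ltW.
move=> x; rewrite normal_pdf01E (normal_pdfE _ s0)/= /normal_fun subr0 sqr_sqrtr//.
rewrite [leRHS]mulrA divfK ?gt_eqF// [leLHS]mulrCA -[leRHS]mulrA [leRHS]mulrCA ler_pM2l//.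
have -> : - x ^+ 2 / (2 *+ 2) = x ^+ 2 / 4 - x ^+ 2 / 2 :> R by field.
rewrite expRD mulrA ler_pM2r ?expR_gt0//.
apply: le_trans (_ : (1 + x ^+ 2) ^+ k.+1 <= _).
  by rewrite ler_weXn2l ?one_sqr_ge1.
(* Taking a root turns the polynomial bound into the linear one [1 + y <= exp y]. The root is of
   order [k.+1], not [k], so that it makes sense for [k = 0]. *)
have -> : expR (x ^+ 2 / 4) = expR (x ^+ 2 / (4 * k.+1%:R)) ^+ k.+1 :> R.
  by rewrite -expRM_natr; congr expR; field; rewrite nat1r pnatr_eq0.
rewrite -exprMn lerXn2r ?nnegrE//.
  by rewrite (le_trans _ (one_sqr_ge1 _)).
apply: le_trans (_ : 4 * k.+1%:R * (1 + x ^+ 2 / (4 * k.+1%:R)) <= _); last first.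
  by rewrite ler_pM2l ?mulr_gt0// expR_ge1Dx.
have -> : 4 * k.+1%:R * (1 + x ^+ 2 / (4 * k.+1%:R)) = 4 * k.+1%:R + x ^+ 2 :> R.
  by field; rewrite nat1r pnatr_eq0.
by rewrite lerD2r -natrM ler1n.
Qed.

Lemma integrable_poly_normal k :
  (normal_prob 0 1).-integrable [set: RT] (fun x => ((1 + x ^+ 2) ^+ k : R)%:E).
Proof.
apply/integrable_normal_prob.
  by apply: measurable_funX; apply: measurable_funD => //; exact: measurable_funX.
have [c c0 le_c] := poly_normal_pdf_le k.
apply: (@le_integrable _ _ _ mu _ measurableT _
    (fun x => (c * normal_pdf 0 (Num.sqrt 2) x)%:E)).
- apply/measurable_EFinP; apply: measurable_funM; last exact: measurable_normal_pdf.
  by apply: measurable_funX; apply: measurable_funD => //; exact: measurable_funX.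
- move=> x _; rewrite lee_fin !ger0_norm ?le_c//.
    by rewrite mulr_ge0 ?normal_pdf_ge0.
  by rewrite mulr_ge0 ?normal_pdf_ge0// exprn_ge0// (le_trans _ (one_sqr_ge1 _)).
- under eq_fun do rewrite EFinM.
  by apply: integrableZl => //; exact: integrable_normal_pdf.
Qed.

Lemma integrable_le_poly_normal (F : RT -> R) k C : measurable_fun setT F ->
  (forall x, `|F x| <= C * (1 + x ^+ 2) ^+ k) ->
  (normal_prob 0 1).-integrable [set: RT] (EFin \o F).
Proof.
move=> mF FC.
apply: (@le_integrable _ _ _ (normal_prob 0 1) _ measurableT _
    (fun x => (C * (1 + x ^+ 2) ^+ k)%:E)) => //.
- exact/measurable_EFinP.
- by move=> x _; rewrite lee_fin (le_trans (FC x))// ler_norm.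
- under eq_fun do rewrite EFinM.
  by apply: integrableZl => //; exact: integrable_poly_normal.
Qed.

(** The density absorbs one factor [1 + x^2] more than the growth of [F] requires. What is left
    decays like [K / (1 + x^2)], which is at most [K / (n + 1)] at both endpoints. *)
Lemma normal_boundary_cvg0 (F : R -> R) k C :
  (forall x, `|F x| <= C * (1 + x ^+ 2) ^+ k) ->
  (F n.+1%:R * normal_pdf 0 1 n.+1%:R : R) @[n --> \oo] --> (0 : R) /\
  (F (- n.+1%:R) * normal_pdf 0 1 (- n.+1%:R) : R) @[n --> \oo] --> (0 : R).
Proof.
move=> FC.
have s0 : Num.sqrt 2 != 0 :> R by rewrite sqrtr_eq0 -ltNge.
have C0 : 0 <= C by have := FC 0; rewrite expr0n addr0 expr1n mulr1; exact: le_trans.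
have [c c0 le_c] := poly_normal_pdf_le k.+1.
pose K := C * (c * normal_peak (Num.sqrt 2)).
have K0 : 0 <= K by rewrite !mulr_ge0// normal_peak_ge0.
have bnd x : `|F x * normal_pdf 0 1 x| <= K / (1 + x ^+ 2).
  have w0 : 0 < 1 + x ^+ 2 by rewrite (lt_le_trans _ (one_sqr_ge1 _)).
  rewrite normrM (ger0_norm (normal_pdf_ge0 _ _ _)) ler_pdivlMr//.
  apply: le_trans (_ : C * (1 + x ^+ 2) ^+ k * normal_pdf 0 1 x * (1 + x ^+ 2) <= _).
    by rewrite ler_wpM2r ?(ltW w0)// ler_wpM2r ?normal_pdf_ge0.
  rewrite -!mulrA ler_wpM2l// [X in _ * X <= _]mulrC mulrA -exprSr.
  apply: le_trans (le_c x) _; rewrite ler_wpM2l// normal_pdf_ub//.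
have cvgK : (K * harmonic n) @[n --> \oo] --> (0 : R).
  by rewrite -[X in _ --> X](mulr0 K); apply: cvgMr; exact: cvg_harmonic.
have le_harm n (x : R) : x ^+ 2 = n.+1%:R ^+ 2 -> K / (1 + x ^+ 2) <= K * harmonic n.
  move=> ->; rewrite ler_wpM2l//= lef_pV2 ?posrE ?ltr0n//.
  rewrite (@le_trans _ _ (n.+1%:R ^+ 2))//; last by rewrite lerDr.
  by rewrite expr2 ler_peMr// ler1n.
split; apply/norm_cvg0P; apply: (@squeeze_cvgr _ _ _ _ (cst 0) (fun n => K * harmonic n)).
all: try exact: cvg_cst.
all: try exact: cvgK.
all: apply: nearW => n; rewrite normr_ge0/=; apply: le_trans (bnd _) _; apply: le_harm.
  by [].
by rewrite sqrrN.
Qed.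

Lemma cvg_Rintegral_growing_itv (v : R -> R) : mu.-integrable setT (EFin \o v) ->
  (\int[mu]_(x in `[- n.+1%:R, n.+1%:R]) v x) @[n --> \oo] --> \int[mu]_x v x.
Proof.
move=> iv.
pose f_ n := (EFin \o v) \_ (`[- n.+1%:R, n.+1%:R]%classic : set RT).
have mf_ n : measurable_fun setT (f_ n).
  apply/(measurable_restrictT _ _).1 => //.
  exact: measurable_funS (measurable_int _ iv).
have f_f : {ae mu, forall x, setT x -> f_ ^~ x @ \oo --> (EFin \o v) x}.
  apply: aeW => x _; apply: cvg_near_cst.
  near=> n; rewrite /f_ patchE mem_set//= in_itv/= -ler_norml.
  by rewrite (@le_trans _ _ n%:R) ?ler_nat//; near: n; exact: nbhs_infty_ger.
have le_f : {ae mu, forall x n, setT x -> (`|f_ n x| <= (abse \o (EFin \o v)) x)%E}.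
  by apply: aeW => x n _; rewrite /f_ patchE; case: ifP => // _; rewrite abse0 abse_ge0.
have [_ _] := dominated_convergence measurableT mf_ (measurable_int _ iv) f_f
  (integrable_abse iv) le_f.
rewrite -[X in _ --> X]fineK; last exact: integrable_fin_num.
move=> /fine_cvgP[_]; rewrite /Rintegral; apply: cvg_trans.
apply: near_eq_cvg; apply: nearW => n /=.
by rewrite /f_ -integral_mkcond.
Unshelve. all: by end_near. Qed.

(* Stein's lemma for the standard normal law, by integrating [(F p)' = G p - x F p]
   over [[-n, n]]. *)
Lemma normal_ibp (F G : R -> R) (k : nat) (C : R) :
  (forall x : R, is_derive x 1 F (G x)) -> continuous G ->
  (forall x, `|F x| <= C * (1 + x ^+ 2) ^+ k) ->
  (forall x, `|G x| <= C * (1 + x ^+ 2) ^+ k) ->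
  \int[normal_prob 0 1]_x (x * F x) = \int[normal_prob 0 1]_x G x.
Proof.
move=> dF cG FC GC.
have C0 : 0 <= C by have := FC 0; rewrite expr0n addr0 expr1n mulr1; exact: le_trans.
have cF : continuous F.
  by move=> x; apply: differentiable_continuous; apply/derivable1_diffP; exact: ex_derive.
pose p := @normal_pdf R 0 1.
have cp : continuous p by apply: continuous_normal_pdf; exact: oner_neq0.
have mF : measurable_fun setT F by exact: continuous_measurable_fun.
have mG : measurable_fun setT G by exact: continuous_measurable_fun.
have iG := integrable_le_poly_normal mG GC.
have ixF : (normal_prob 0 1).-integrable [set: RT] (EFin \o (fun x => x * F x)).
  apply: (@integrable_le_poly_normal _ k.+1 C); first exact: measurable_funM.
  move=> x; rewrite normrM [X in _ <= _ * X]exprS mulrCA.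
  by rewrite ler_pM ?FC ?norm_le_one_sqr.
have dFp (x : R) : is_derive x 1 (F * p) (G x * p x - x * F x * p x).
  have dFx := dF x; have dpx := is_derive_normal_pdf x (oner_neq0 R).
  by apply: is_derive_eq; rewrite /GRing.scale/= -/p; field.
pose v x := G x * p x - x * F x * p x.
have cv : continuous v.
  move=> x; apply: cvgB; first by apply: cvgM; [exact: cG|exact: cp].
  by apply: cvgM; [apply: cvgM; [exact: cvg_id|exact: cF]|exact: cp].
have iGp : mu.-integrable setT (fun x => (G x * p x)%:E).
  exact/integrable_normal_prob.
have iFp : mu.-integrable setT (fun x => (x * F x * p x)%:E).
  by apply/(@integrable_normal_prob _ _ _ (fun x => x * F x)) => //; exact: measurable_funM.
have iv : mu.-integrable setT (EFin \o v).
  by apply: (integrableB measurableT iGp iFp).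
have v_itv n : \int[mu]_(x in `[- n.+1%:R, n.+1%:R]) v x =
    F n.+1%:R * p n.+1%:R - F (- n.+1%:R) * p (- n.+1%:R).
  rewrite /Rintegral (@continuous_FTC2 _ v (F * p))//.
  - by rewrite gtrN.
  - exact: continuous_subspaceT.
  - have cFp x : {for x, continuous (F * p)} by apply: cvgM; [exact: cF|exact: cp].
    split=> [x _||]; first exact: ex_derive.
      exact/cvg_at_right_filter/cFp.
    exact/cvg_at_left_filter/cFp.
  - by move=> x _; rewrite derive1E derive_val.
have [up un] := normal_boundary_cvg0 FC.
have v0 : \int[mu]_x v x = 0.
  have := cvg_Rintegral_growing_itv iv; under eq_fun do rewrite v_itv.
  move=> /(cvg_unique _); apply; first exact: Rhausdorff.
  by have := cvgB up un; rewrite subr0 => H; exact: H.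
rewrite !Rintegral_normal_prob//; apply/eqP; rewrite eq_sym -subr_eq0.
by rewrite -RintegralB// v0.
Qed.

End gaussian_polynomials.

(** * The standard Gaussian vector *)

Section power_measure_integral.
Context d (T : measurableType d) (R : realType).
Variables (mu : {sigma_finite_measure set T -> \bar R}) (n : nat).
Local Open Scope ereal_scope.

Lemma ge0_integral_power_measureS (f : n.+1.-tuple T -> \bar R) :
  measurable_fun setT f -> (forall t, 0 <= f t) ->
  \int[power_measure mu n.+1]_t f t =
  \int[mu]_x \int[power_measure mu n]_t f (tuple_cons (x, t)).
Proof.
move=> mf f0 /=.
rewrite /cons_measure ge0_integral_pushforward//; last exact: measurable_tuple_cons.
rewrite preimage_setT (fubini_tonelli1 (f \o @tuple_cons _ _ _))//.
- by apply: measurableT_comp => //; exact: measurable_tuple_cons.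
- by move=> x; exact: f0.
Qed.

Let integrable_cons (f : n.+1.-tuple T -> \bar R) :
  (power_measure mu n.+1).-integrable setT f ->
  (mu \x power_measure mu n).-integrable setT (f \o @tuple_cons _ _ _).
Proof.
move=> /integrableP[mf foo]; have mc := @measurable_tuple_cons _ T n.
apply/integrableP; split; first exact: measurableT_comp.
move: foo; rewrite /= /cons_measure ge0_integral_pushforward//.
exact: measurableT_comp.
Qed.

Lemma integral_power_measureS12 (f : n.+1.-tuple T -> \bar R) :
  (power_measure mu n.+1).-integrable setT f ->
  \int[power_measure mu n.+1]_t f t =
  \int[mu]_x \int[power_measure mu n]_t f (tuple_cons (x, t)).
Proof.
move=> intf; rewrite /= /cons_measure integral_pushforward//.
- by rewrite preimage_setT -integral12_prod_meas1//; exact: integrable_cons.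
- exact: measurable_tuple_cons.
- exact: measurable_int intf.
- exact: integrable_cons.
Qed.

Lemma integral_power_measureS21 (f : n.+1.-tuple T -> \bar R) :
  (power_measure mu n.+1).-integrable setT f ->
  \int[power_measure mu n.+1]_t f t =
  \int[power_measure mu n]_t \int[mu]_x f (tuple_cons (x, t)).
Proof.
move=> intf; rewrite integral_power_measureS12// -(@Fubini _ _ _ _ _ _ _ (f \o @tuple_cons _ _ _))//.
exact: integrable_cons.
Qed.

End power_measure_integral.

Section gaussian_vector.
Context {R : realType}.
Local Notation RT := (measurableTypeR R).

Definition gauss n : {sigma_finite_measure set (n.-tuple RT) -> \bar R} :=
  power_measure (normal_prob (0 : R) 1) n.

Lemma gauss_setT n : gauss n setT = 1%E.
Proof.
have -> : [set: n.-tuple RT] = [set t | forall i, [set: RT] (tnth t i)].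
  by apply/seteqP; split.
have N1 : normal_prob (0 : R) 1 setT = 1%E by exact: probability_setT.
by rewrite /gauss power_measure_cube// [X in (X ^+ _)%E]N1 -EFin_expe expr1n.
Qed.


(** A product rather than [1 + |t|^2]: it factors under [tuple_cons], so integrals and bounds
    descend one coordinate at a time, and it still dominates every coordinate. *)
Definition weight n (t : n.-tuple RT) : R := \prod_i (1 + tnth t i ^+ 2).

Lemma weight_cons n (x : RT) (t : n.-tuple RT) :
  weight (tuple_cons (x, t)) = (1 + x ^+ 2) * weight t.
Proof.
rewrite /weight big_ord_recl; congr (_ * _).
by apply: eq_bigr => i _; rewrite tnthS.
Qed.

Lemma weight_ge1 n (t : n.-tuple RT) : 1 <= weight t.
Proof. by apply: (big_ind (fun x => 1 <= x)) => // [x y|i _]; [exact: mulr_ege1|exact: one_sqr_ge1]. Qed.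

Lemma measurable_weight n : measurable_fun setT (@weight n).
Proof.
apply: measurable_prod => i _; apply: measurable_funD => //.
by apply: measurable_funX; exact: measurable_tnth.
Qed.


(** By Tonelli the integral is the [n]-th power of the one-dimensional moment [c], which is
    finite. *)
Lemma integrable_weight n k :
  (gauss n).-integrable setT (fun t => (weight t ^+ k : R)%:E).
Proof.
have w0 m (t : m.-tuple RT) : 0 <= weight t ^+ k.
  by rewrite exprn_ge0// (le_trans _ (weight_ge1 _)).
have mw m : measurable_fun setT (fun t : m.-tuple RT => (weight t ^+ k : R)%:E).
  by apply/measurable_EFinP; apply: measurable_funX; exact: measurable_weight.
suff [c int_w] : exists c : R, (\int[gauss n]_t (weight t ^+ k : R)%:E)%E = c%:E.
  apply/integrableP; split; first exact: mw.
  under eq_integral do rewrite gee0_abs ?lee_fin//.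
  by rewrite int_w ltry.
have [c int_c] : exists c : R, (\int[normal_prob (0 : R) 1]_x ((1 + x ^+ 2) ^+ k : R)%:E)%E = c%:E.
  exists (fine (\int[normal_prob (0 : R) 1]_x ((1 + x ^+ 2) ^+ k : R)%:E)%E).
  by rewrite fineK//; apply: integrable_fin_num => //; exact: integrable_poly_normal.
exists (c ^+ n); elim: n => [|n IHn].
  rewrite /gauss integral_dirac//; last exact: mw.
  by rewrite diracT mul1e /weight big_ord0 expr1n.
rewrite /gauss ge0_integral_power_measureS//; last by move=> t; rewrite lee_fin.
rewrite exprS EFinM -int_c.
transitivity (\int[normal_prob (0 : R) 1]_x (((1 + x ^+ 2) ^+ k : R)%:E * (c ^+ n)%:E))%E.
  apply: eq_integral => x _; rewrite -IHn -ge0_integralZl//.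
  - by apply: eq_integral => t _; rewrite weight_cons exprMn EFinM.
  - exact: mw.
  - by move=> t _; rewrite lee_fin.
  - by rewrite lee_fin exprn_ge0// (le_trans _ (one_sqr_ge1 _)).
rewrite ge0_integralZr//.
- apply/measurable_EFinP; apply: measurable_funX; apply: measurable_funD => //.
- by move=> x _; rewrite lee_fin exprn_ge0// (le_trans _ (one_sqr_ge1 _)).
- by rewrite -IHn integral_ge0// => t _; rewrite lee_fin.
Qed.

(* A class of functions of polynomial growth that is stable under fixing a coordinate. *)
Definition tame n (F : n.-tuple RT -> R) :=
  measurable_fun setT F /\ exists k C, forall t, `|F t| <= C * weight t ^+ k.

Lemma tame_measurable n (F : n.-tuple RT -> R) : tame F -> measurable_fun setT F.
Proof. by case. Qed.

Lemma tame_bound n (F : n.-tuple RT -> R) : tame F ->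
  exists k C, 0 <= C /\ forall t, `|F t| <= C * weight t ^+ k.
Proof.
move=> [_ [k [C FC]]]; exists k, C; split=> //.
have := FC [tuple 0 | i < n]; have w1 := weight_ge1 [tuple (0 : RT) | i < n].
have wk : 0 < weight [tuple (0 : RT) | i < n] ^+ k by rewrite exprn_gt0// (lt_le_trans _ w1).
by move=> /(le_trans (normr_ge0 _)); rewrite pmulr_lge0.
Qed.

Lemma tame_integrable n (F : n.-tuple RT -> R) : tame F ->
  (gauss n).-integrable setT (EFin \o F).
Proof.
move=> [mF [k [C FC]]].
apply: (@le_integrable _ _ _ (gauss n) _ measurableT _ (fun t => (C * weight t ^+ k)%:E)).
- exact/measurable_EFinP.
- by move=> t _; rewrite lee_fin (le_trans (FC t))// ler_norm.
- under eq_fun do rewrite EFinM.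
  by apply: integrableZl => //; exact: integrable_weight.
Qed.

Lemma tame_le n (F G : n.-tuple RT -> R) : measurable_fun setT F ->
  (forall t, `|F t| <= `|G t|) -> tame G -> tame F.
Proof.
by move=> mF FG [_ [k [C GC]]]; split=> //; exists k, C => t; exact: le_trans (FG t) (GC t).
Qed.

Lemma tame_cst n (c : R) : tame (fun _ : n.-tuple RT => c).
Proof. by split=> //; exists 0%N, `|c| => t; rewrite expr0 mulr1. Qed.

Lemma tame_tnth n (i : 'I_n) : tame (fun t : n.-tuple RT => tnth t i : R).
Proof.
split; first exact: measurable_tnth.
exists 1%N, 1 => t; rewrite mul1r expr1 (le_trans (norm_le_one_sqr _))//.
rewrite /weight (bigD1 i)//= ler_peMr ?(le_trans _ (one_sqr_ge1 _))//.
by apply: (big_ind (fun x => 1 <= x)) => // [y z|j _]; [exact: mulr_ege1|exact: one_sqr_ge1].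
Qed.

Lemma tameD n (F G : n.-tuple RT -> R) : tame F -> tame G -> tame (fun t => F t + G t).
Proof.
move=> tF tG; split; first exact: measurable_funD (tame_measurable tF) (tame_measurable tG).
have [k [C [C0 FC]]] := tame_bound tF; have [l [D [D0 GD]]] := tame_bound tG.
exists (k + l)%N, (C + D) => t; rewrite (le_trans (ler_normD _ _))// mulrDl.
have w1 := weight_ge1 t.
apply: lerD.
  by rewrite (le_trans (FC t))// ler_wpM2l// ler_weXn2l// leq_addr.
by rewrite (le_trans (GD t))// ler_wpM2l// ler_weXn2l// leq_addl.
Qed.

Lemma tameM n (F G : n.-tuple RT -> R) : tame F -> tame G -> tame (fun t => F t * G t).
Proof.
move=> tF tG; split; first exact: measurable_funM (tame_measurable tF) (tame_measurable tG).
have [k [C [C0 FC]]] := tame_bound tF; have [l [D [D0 GD]]] := tame_bound tG.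
by exists (k + l)%N, (C * D) => t; rewrite normrM exprD mulrACA ler_pM.
Qed.

Lemma tame_sum n I (r : seq I) (F : I -> n.-tuple RT -> R) :
  (forall i, tame (F i)) -> tame (fun t => \sum_(i <- r) F i t).
Proof.
move=> tF; elim: r => [|i r IHr].
  by under eq_fun do rewrite big_nil; exact: tame_cst.
by under eq_fun do rewrite big_cons; exact: tameD.
Qed.

Lemma tame_norm n (F : n.-tuple RT -> R) : tame F -> tame (fun t => `|F t|).
Proof.
move=> tF; apply: tame_le (tF) => [|t]; last by rewrite normr_id.
by apply: measurableT_comp => //; exact: tame_measurable tF.
Qed.

Lemma tame_cons n (F : n.+1.-tuple RT -> R) x : tame F ->
  tame (fun t => F (tuple_cons (x, t))).
Proof.
move=> tF; split.
  apply: measurableT_comp; first exact: tame_measurable tF.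
  by apply: measurableT_comp; [exact: measurable_tuple_cons|exact: measurable_pair1].
have [_ [k [C FC]]] := tF; exists k, (C * (1 + x ^+ 2) ^+ k) => t.
by rewrite -mulrA -exprMn -weight_cons.
Qed.

Lemma gauss_Fubini12 n (F : n.+1.-tuple RT -> R) : tame F ->
  \int[gauss n.+1]_t F t =
  \int[normal_prob (0 : R) 1]_x \int[gauss n]_t F (tuple_cons (x, t)).
Proof.
move=> tF; rewrite /Rintegral /gauss integral_power_measureS12; last exact: tame_integrable.
congr fine; apply: eq_integral => x _; rewrite fineK//.
by apply: integrable_fin_num => //; apply: tame_integrable; exact: tame_cons.
Qed.

Lemma tame_integrable_head n (F : n.+1.-tuple RT -> R) t : tame F ->
  (normal_prob (0 : R) 1).-integrable setT (EFin \o (fun x => F (tuple_cons (x, t)))).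
Proof.
move=> [mF [k [C FC]]]; apply: (@integrable_le_poly_normal _ _ k (C * weight t ^+ k)).
  apply: measurableT_comp => //.
  by apply: measurableT_comp; [exact: measurable_tuple_cons|exact: measurable_pair2].
by move=> x; rewrite (le_trans (FC _))// weight_cons exprMn -mulrA (mulrC (weight t ^+ k)).
Qed.

Lemma gauss_Fubini21 n (F : n.+1.-tuple RT -> R) : tame F ->
  \int[gauss n.+1]_t F t =
  \int[gauss n]_t \int[normal_prob (0 : R) 1]_x F (tuple_cons (x, t)).
Proof.
move=> tF; rewrite /Rintegral /gauss integral_power_measureS21; last exact: tame_integrable.
congr fine; apply: eq_integral => t _; rewrite fineK//.
by apply: integrable_fin_num => //; exact: tame_integrable_head.
Qed.

(** Partial derivatives in coordinate [i] are expressed as ordinary derivatives of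
    [u |-> F (upd i u t)]. *)
Definition upd n (i : 'I_n) (u : R) (t : n.-tuple RT) : n.-tuple RT :=
  [tuple (if j == i then u else tnth t j : RT) | j < n].

Lemma upd_head n u x (t : n.-tuple RT) : upd ord0 u (tuple_cons (x, t)) = tuple_cons (u, t).
Proof.
apply: eq_from_tnth => j; rewrite tnth_mktuple.
by case: (unliftP ord0 j) => [k ->|->]; rewrite ?tnthS// tnth0.
Qed.

Lemma upd_lift n (i : 'I_n) u x (t : n.-tuple RT) :
  upd (lift ord0 i) u (tuple_cons (x, t)) = tuple_cons (x, upd i u t).
Proof.
apply: eq_from_tnth => j; rewrite tnth_mktuple.
case: (unliftP ord0 j) => [k ->|->]; rewrite ?tnthS ?tnth0//.
by rewrite tnth_mktuple (inj_eq lift_inj).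
Qed.

(** Induction on the dimension, with both orders of Fubini. If [i] is not the head, the head is
    frozen and the induction hypothesis applies to the tail; if it is the head, the tail is frozen
    and the one-dimensional lemma applies. *)
Lemma gauss_ibp n (i : 'I_n) (F G : n.-tuple RT -> R) : tame F -> tame G ->
  (forall t (s : R), is_derive s 1 (fun u => F (upd i u t)) (G (upd i s t))) ->
  (forall t, continuous (fun u => G (upd i u t))) ->
  \int[gauss n]_t (tnth t i * F t) = \int[gauss n]_t G t.
Proof.
elim: n i F G => [[]//|n IHn] i F G tF tG dF cG.
have txF : tame (fun t => tnth t i * F t) by apply: tameM => //; exact: tame_tnth.
case: (unliftP ord0 i) => [j|] ei; subst i.
  rewrite gauss_Fubini12// (gauss_Fubini12 tG); apply: eq_Rintegral => x _.
  under eq_Rintegral do rewrite tnthS.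
  apply: IHn; [exact: tame_cons|exact: tame_cons| |] => t.
    by move=> s; have := dF (tuple_cons (x, t)) s; under eq_fun do rewrite upd_lift; rewrite upd_lift.
  by have := cG (tuple_cons (x, t)); under eq_fun do rewrite upd_lift.
rewrite gauss_Fubini21// (gauss_Fubini21 tG); apply: eq_Rintegral => t _.
under eq_Rintegral do rewrite tnth0.
have [k [C [C0 FC]]] := tame_bound tF; have [l [D [D0 GD]]] := tame_bound tG.
have w1 u := weight_ge1 (tuple_cons (u, t)).
apply: (@normal_ibp _ _ _ (k + l) ((C + D) * weight t ^+ (k + l))).
- by move=> s; have := dF (tuple_cons (s, t)) s; under eq_fun do rewrite upd_head; rewrite upd_head.
- by have := cG (tuple_cons ((0 : RT), t)); under eq_fun do rewrite upd_head.
- move=> x; rewrite -mulrA -exprMn [weight t * _]mulrC -weight_cons (le_trans (FC _))//.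
  by rewrite ler_pM// ?exprn_ge0 ?(le_trans _ (w1 _))// ?lerDl// ler_weXn2l// leq_addr.
- move=> x; rewrite -mulrA -exprMn [weight t * _]mulrC -weight_cons (le_trans (GD _))//.
  by rewrite ler_pM// ?exprn_ge0 ?(le_trans _ (w1 _))// ?lerDr// ler_weXn2l// leq_addl.
Qed.

End gaussian_vector.

(** * Quadratic forms of a Gaussian vector *)

Section derive_extra.
Context {R : realType}.

Lemma is_derive_sum_ord n (f : 'I_n -> R -> R) (d : 'I_n -> R) (x : R) :
  (forall i, is_derive x 1 (f i) (d i)) ->
  is_derive x 1 (fun u => \sum_i f i u) (\sum_i d i).
Proof.
move=> fd; have -> : (fun u => \sum_i f i u) = \sum_i f i by apply/funext => u; rewrite fct_sumE.
exact: is_derive_sum.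
Qed.

Lemma is_derive_continuous (f : R -> R) (x d : R) : is_derive x 1 f d -> {for x, continuous f}.
Proof.
move=> fd; apply: differentiable_continuous; apply/derivable1_diffP; exact: ex_derive.
Qed.

(** Mean value theorem on the segment between 0 and [x]. It is what makes a function with bounded
    derivative tame after composition with a quadratic form. *)
Lemma bounded_derive_growth (g g' : R -> R) (L : R) :
  (forall x : R, is_derive x 1 g (g' x)) -> (forall x, `|g' x| <= L) ->
  forall x, `|g x| <= `|g 0| + L * `|x|.
Proof.
move=> dg g'L x; rewrite -lerBlDl (le_trans (lerB_dist _ _))//.
have [|x0] := leP 0 x.
  rewrite le_eqVlt => /predU1P[<-|x0]; first by rewrite !subrr normr0 mulr0.
  have [] := @MVT _ g g' 0 x x0 (fun y _ => dg y).
    by apply: continuous_subspaceT => y; exact: is_derive_continuous (dg y).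
  by move=> y _ ->; rewrite subr0 normrM ler_wpM2r.
have [] := @MVT _ g g' x 0 x0 (fun y _ => dg y).
  by apply: continuous_subspaceT => y; exact: is_derive_continuous (dg y).
by move=> y _ e; rewrite distrC e sub0r normrM normrN ler_wpM2r.
Qed.

End derive_extra.

Section quadratic_forms.
Context {R : realType}.
Local Notation RT := (measurableTypeR R).
Variable n : nat.
Implicit Types (B C : 'M[R]_n) (t : n.-tuple RT) (i : 'I_n).

Definition lin B t i : R := \sum_j B i j * tnth t j.
Definition qf B t : R := \sum_i tnth t i * lin B t i.

Lemma tame_lin B i : tame (lin B ^~ i).
Proof. by apply: tame_sum => j; apply: tameM; [exact: tame_cst|exact: tame_tnth]. Qed.

Lemma tame_qf B : tame (qf B).
Proof. by apply: tame_sum => i; apply: tameM; [exact: tame_tnth|exact: tame_lin]. Qed.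

Lemma tame_comp_qf B (g g' : R -> R) (L : R) :
  (forall x : R, is_derive x 1 g (g' x)) -> (forall x, `|g' x| <= L) ->
  tame (g \o qf B).
Proof.
move=> dg g'L.
apply: (@tame_le _ _ _ (fun t => `|g 0| + L * `|qf B t|)).
- apply: measurableT_comp; last exact: tame_measurable (tame_qf B).
  by apply: continuous_measurable_fun => x; exact: is_derive_continuous (dg x).
- by move=> t; rewrite (le_trans (bounded_derive_growth dg g'L _))// ler_norm.
- apply: tameD; first exact: tame_cst.
  by apply: tameM; [exact: tame_cst|exact: tame_norm (tame_qf B)].
Qed.

Lemma tame_comp_bounded B (g : R -> R) (L : R) :
  continuous g -> (forall x, `|g x| <= L) -> tame (g \o qf B).
Proof.
move=> cg gL; apply: (@tame_le _ _ _ (fun=> L)); last exact: tame_cst.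
- apply: measurableT_comp; last exact: tame_measurable (tame_qf B).
  exact: continuous_measurable_fun.
- by move=> t; rewrite (le_trans (gL _))// ler_norm.
Qed.

Lemma is_derive_upd i j t (s : R) :
  is_derive s 1 (fun u : R => tnth (upd i u t) j : R) (j == i)%:R.
Proof.
under eq_fun do rewrite tnth_mktuple.
by case: eqP => _; [exact: is_derive_id|exact: is_derive_cst].
Qed.

Lemma is_derive_lin C i k t (s : R) :
  is_derive s 1 (fun u : R => lin C (upd i u t) k) (C k i).
Proof.
have -> : C k i = \sum_j C k j * (j == i)%:R.
  by rewrite (bigD1 i)//= eqxx mulr1 big1 ?addr0// => j /negPf ->; rewrite mulr0.
apply: is_derive_sum_ord => j; have du := is_derive_upd i j t s.
exact: is_derive_eq.
Qed.

Lemma is_derive_qf B i t (s : R) : B^T = B ->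
  is_derive s 1 (fun u : R => qf B (upd i u t)) (2 * lin B (upd i s t) i).
Proof.
move=> symB.
have -> : 2 * lin B (upd i s t) i =
    \sum_j (tnth (upd i s t) j * B j i + lin B (upd i s t) j * (j == i)%:R).
  rewrite big_split/= mulr_natl mulr2n; congr (_ + _).
    by apply: eq_bigr => j _; rewrite -{1}symB mxE mulrC.
  by rewrite (bigD1 i)//= eqxx mulr1 big1 ?addr0// => j /negPf ->; rewrite mulr0.
apply: is_derive_sum_ord => j.
have du := is_derive_upd i j t s; have dl := is_derive_lin B i j t s.
by apply: is_derive_eq.
Qed.

(* Stein's lemma in every coordinate, applied to [(C t)_i g(<B t, t>)] and summed over [i]. *)
Lemma gauss_qf_ibp C B (g g' : R -> R) (L : R) : B^T = B ->
  (forall x : R, is_derive x 1 g (g' x)) -> continuous g' -> (forall x, `|g' x| <= L) ->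
  \int[gauss n]_t (qf C t * g (qf B t)) =
  \tr C * \int[gauss n]_t g (qf B t) +
  2 * \int[gauss n]_t ((\sum_i lin C t i * lin B t i) * g' (qf B t)).
Proof.
move=> symB dg cg' g'L.
have tg := tame_comp_qf B dg g'L; have tg' := tame_comp_bounded B cg' g'L.
pose F i t := lin C t i * g (qf B t).
(* Product rule in coordinate [i]: the factor [(C t)_i] contributes [C i i], and [g(<B t, t>)]
   contributes [2 (B t)_i g']. Summation over [i] yields the trace of [C] and the inner product of
   [C t] with [B t]. *)
pose G i t := C i i * g (qf B t) + 2 * (lin C t i * lin B t i * g' (qf B t)).
have tF i : tame (F i) by apply: tameM => //; exact: tame_lin.
have tG2 i : tame (fun t => lin C t i * lin B t i * g' (qf B t)).
  by apply: tameM => //; apply: tameM; exact: tame_lin.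
have tG i : tame (G i).
  by apply: tameD; apply: tameM => //; exact: tame_cst.
have dF i t (s : R) : is_derive s 1 (fun u => F i (upd i u t)) (G i (upd i s t)).
  have dl := is_derive_lin C i i t s; have dq := is_derive_qf i t s symB.
  have dgq : is_derive s 1 (fun u => g (qf B (upd i u t)))
      (2 * lin B (upd i s t) i * g' (qf B (upd i s t))).
    have := @is_derive1_comp _ g (fun u => qf B (upd i u t)) s _ _ (dg _) dq.
    by rewrite mulrC.
  by apply: is_derive_eq; rewrite /GRing.scale/= /G; ring.
have cl D i k t : continuous (fun u => lin D (upd i u t) k).
  by move=> s; exact: is_derive_continuous (is_derive_lin D i k t s).
have cq i t : continuous (fun u => qf B (upd i u t)).
  by move=> s; exact: is_derive_continuous (is_derive_qf i t s symB).
have cG i t : continuous (fun u => G i (upd i u t)).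
  move=> s; apply: cvgD; apply: cvgM; try exact: cvg_cst.
    apply: (@continuous_comp _ _ _ (fun u => qf B (upd i u t)) g); first exact: cq.
    exact: is_derive_continuous (dg _).
  apply: cvgM; first by apply: cvgM; exact: cl.
  by apply: (@continuous_comp _ _ _ (fun u => qf B (upd i u t)) g'); [exact: cq|exact: cg'].
have ibp i := gauss_ibp (tF i) (tG i) (dF i) (cG i).
have sumE (f : 'I_n -> n.-tuple RT -> R) : (forall i, tame (f i)) ->
    \int[gauss n]_t (\sum_i f i t) = \sum_i \int[gauss n]_t f i t.
  move=> tf; elim: (index_enum _) => [|i r IHr].
    rewrite big_nil; under eq_Rintegral do rewrite big_nil.
    by rewrite Rintegral_cst// mul0r.
  rewrite big_cons -IHr -RintegralD//.
  - by apply: eq_Rintegral => t _; rewrite big_cons.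
  - exact: tame_integrable.
  - by apply: tame_integrable; exact: tame_sum.
transitivity (\sum_i \int[gauss n]_t (tnth t i * F i t)).
  rewrite -sumE => [|i]; last by apply: tameM => //; exact: tame_tnth.
  by apply: eq_Rintegral => t _; rewrite /qf mulr_suml; apply: eq_bigr => i _; rewrite mulrA.
rewrite (eq_bigr _ (fun i _ => ibp i)) -sumE//.
rewrite -RintegralZl//; last exact: tame_integrable.
rewrite -RintegralZl//; last first.
  by apply: tame_integrable; apply: tameM => //; apply: tame_sum => i; apply: tameM; exact: tame_lin.
rewrite -RintegralD//.
- apply: eq_Rintegral => t _; rewrite /G big_split/= -mulr_suml; congr (_ + _).
  by rewrite -mulr_sumr -mulr_suml.
- by apply: tame_integrable; apply: tameM => //; exact: tame_cst.
- apply: tame_integrable; apply: tameM; first exact: tame_cst.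
  by apply: tameM => //; apply: tame_sum => i; apply: tameM; exact: tame_lin.
Qed.

End quadratic_forms.

Section gaussian_moments.
Context {R : realType}.
Local Notation RT := (measurableTypeR R).
Variable n : nat.
Implicit Types (B C : 'M[R]_n) (t : n.-tuple RT).

Lemma gauss_cst (c : R) : \int[gauss n]_t c = c.
Proof. by rewrite Rintegral_cst// [X in fine X]gauss_setT mulr1. Qed.

(** Integration by parts against the constant function 1, whose derivative vanishes. *)
Lemma gauss_qf C : \int[gauss n]_t qf C t = \tr C.
Proof.
have := @gauss_qf_ibp R n C 0 (cst 1) (cst 0) 0.
rewrite trmx0 => /(_ erefl).
under eq_Rintegral do rewrite /cst mulr1.
move=> -> //; last by move=> x; rewrite normr0.
  under [X in _ + 2 * X]eq_Rintegral do rewrite mulr0.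
  by rewrite !gauss_cst mulr1 mulr0 addr0.
by move=> x; exact: cvg_cst.
Qed.

Lemma sum_lin_sqr B t : B^T = B -> \sum_i lin B t i * lin B t i = qf (B *m B) t.
Proof.
move=> symB; rewrite /qf.
under eq_bigr do rewrite {1}/lin mulr_suml.
rewrite exchange_big/=; apply: eq_bigr => j _.
rewrite [in RHS]/lin mulr_sumr.
under eq_bigr do rewrite /lin mulr_sumr.
rewrite exchange_big/=; apply: eq_bigr => k _.
rewrite mxE mulr_suml mulr_sumr; apply: eq_bigr => i _.
by rewrite -{1}symB mxE; ring.
Qed.

(** Integration by parts with [g] the identity and both matrices equal to [C]; the remaining
    integrand [|C t|^2] is the quadratic form of [C *m C], whose mean is its trace. *)
Lemma gauss_qf_sqr C : C^T = C ->
  \int[gauss n]_t (qf C t * qf C t) = \tr C ^+ 2 + 2 * \tr (C *m C).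
Proof.
move=> symC; rewrite (@gauss_qf_ibp _ _ _ _ id (cst 1) 1 symC).
- rewrite expr2; congr (_ * _ + 2 * _); first exact: gauss_qf.
  by rewrite -gauss_qf; apply: eq_Rintegral => t _; rewrite mulr1 sum_lin_sqr.
- by move=> x; exact: cvg_cst.
- by move=> x; rewrite normr1.
Qed.

Lemma gauss_qf_var C : C^T = C ->
  \int[gauss n]_t ((qf C t - \tr C) ^+ 2) = 2 * \tr (C *m C).
Proof.
move=> symC; have tq := tame_qf C.
transitivity (\int[gauss n]_t (qf C t * qf C t + (- (2 * \tr C) * qf C t + \tr C ^+ 2))).
  by apply: eq_Rintegral => t _; ring.
have tq2 : tame (fun t => qf C t * qf C t) by exact: tameM.
have tcq : tame (fun t => - (2 * \tr C) * qf C t) by apply: tameM => //; exact: tame_cst.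
rewrite RintegralD//; [|exact: tame_integrable|]; last first.
  by apply: tame_integrable; apply: tameD => //; exact: tame_cst.
rewrite RintegralD//; [|exact: tame_integrable|by apply: tame_integrable; exact: tame_cst].
rewrite RintegralZl//; last exact: tame_integrable.
by rewrite gauss_qf gauss_cst gauss_qf_sqr//; ring.
Qed.

Lemma gauss_le (F G : n.-tuple RT -> R) : tame F -> tame G ->
  (forall t, F t <= G t) -> \int[gauss n]_t F t <= \int[gauss n]_t G t.
Proof. by move=> tF tG FG; apply: le_Rintegral => //; exact: tame_integrable. Qed.

(** Since [B] has trace zero, integration by parts replaces [W f(W)], where [W = c <B t, t>], by
    [2 c^2 <B^2 t, t> f'(W)]. The error is then the distance from [s2] to the mean of
    [2 c^2 <B^2 t, t>], plus the fluctuation of this form, controlled by its variance. The free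
    parameter [eps] spares the square root of the variance. *)
Lemma gauss_stein B (c s2 : R) (f f' : R -> R) (L eps : R) :
  B^T = B -> \tr B = 0 -> 0 < eps ->
  (forall x : R, is_derive x 1 f (f' x)) -> continuous f' -> (forall x, `|f' x| <= L) ->
  `|\int[gauss n]_t (s2 * f' (c * qf B t) - c * qf B t * f (c * qf B t))| <=
  L * (`|s2 - 2 * c ^+ 2 * \tr (B *m B)| + eps +
       2 * (2 * c ^+ 2) ^+ 2 * \tr ((B *m B) *m (B *m B)) / eps).
Proof.
move=> symB trB eps0 df cf' f'L.
have L0 : 0 <= L by rewrite (le_trans _ (f'L 0)).
pose g x := f (c * x); pose g' x := c * f' (c * x).
have dg (x : R) : is_derive x 1 g (g' x).
  have dc : is_derive x 1 (fun u : R => c * u) c.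
    by apply: is_derive_eq; rewrite /GRing.scale/= mulr1.
  have := @is_derive1_comp _ f (fun u => c * u) x _ _ (df _) dc.
  by rewrite /g' mulrC.
have cm : continuous (fun u : R => f' (c * u)).
  move=> x; apply: (@continuous_comp _ _ _ (fun u : R => c * u) f'); last exact: cf'.
  by apply: cvgM; [exact: cvg_cst|exact: cvg_id].
have cg' : continuous g' by move=> x; apply: cvgM; [exact: cvg_cst|exact: cm].
have g'L x : `|g' x| <= `|c| * L by rewrite normrM ler_wpM2l.
have ibp := gauss_qf_ibp B symB dg cg' g'L.
have tq2 := tame_qf (B *m B); have tq := tame_qf B.
have tf' : tame (fun t => f' (c * qf B t)) := tame_comp_bounded B cm (fun x => f'L (c * x)).
have tg : tame (fun t => g (qf B t)) := tame_comp_qf B dg g'L.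
have tg' : tame (fun t => g' (qf B t)) := tame_comp_bounded B cg' g'L.
have tc (k : R) : tame (fun _ : n.-tuple RT => k) by exact: tame_cst.
(* One [c] comes from [W], the other from the derivative of [x |-> f (c x)], and the 2 from the
   gradient of the quadratic form. *)
pose v := 2 * c ^+ 2; have vE : 2 * c ^+ 2 = v by [].
rewrite !vE.
have {}ibp : \int[gauss n]_t (c * qf B t * f (c * qf B t)) =
    \int[gauss n]_t (v * qf (B *m B) t * f' (c * qf B t)).
  transitivity (c * \int[gauss n]_t (qf B t * g (qf B t))).
    rewrite -RintegralZl//; last by apply: tame_integrable; exact: tameM.
    by apply: eq_Rintegral => t _; rewrite /g mulrA.
  rewrite ibp trB mul0r add0r -!RintegralZl//.
  - apply: eq_Rintegral => t _; rewrite sum_lin_sqr// /g' -vE; ring.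
  - apply: tame_integrable; under eq_fun do rewrite sum_lin_sqr//.
    by apply: tameM => //; by apply: tameM.
  - apply: tame_integrable; apply: tameM => //; under eq_fun do rewrite sum_lin_sqr//.
    exact: tq2.
clearbody v.
have tvq : tame (fun t => v * qf (B *m B) t * f' (c * qf B t)).
  by apply: tameM => //; exact: tameM.
rewrite RintegralB//; last 2 first.
  by apply: tame_integrable; exact: tameM.
  by apply: tame_integrable; apply: tameM => //; exact: tameM.
rewrite ibp -RintegralB//; last 2 first.
  by apply: tame_integrable; exact: tameM.
  exact: tame_integrable.
have tD : tame (fun t => s2 * f' (c * qf B t) - v * qf (B *m B) t * f' (c * qf B t)).
  under eq_fun do rewrite -mulNr.
  by apply: tameD; apply: tameM => //; under eq_fun do rewrite -mulNr; exact: tameM.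
apply: le_trans (le_normr_Rintegral measurableT (tame_integrable tD)) _.
set T := \tr (B *m B).
have tvar : tame (fun t => (qf (B *m B) t - T) ^+ 2).
  by under eq_fun do rewrite expr2; apply: tameM; apply: tameD => //.
(* With [y = v * (qf (B *m B) t - T)], the pointwise bound combines the triangle inequality through
   [v * T] with [|y| <= eps + y^2/eps]. *)
apply: le_trans (gauss_le (G := fun t =>
  L * (`|s2 - v * T| + eps) + L * v ^+ 2 / eps * (qf (B *m B) t - T) ^+ 2) _ _ _) _.
- exact: tame_norm.
- by apply: tameD => //; exact: tameM.
- move=> t; rewrite -mulrBl mulrC normrM.
  have -> : L * (`|s2 - v * T| + eps) + L * v ^+ 2 / eps * (qf (B *m B) t - T) ^+ 2 =
      L * (`|s2 - v * T| + (eps + v ^+ 2 * (qf (B *m B) t - T) ^+ 2 / eps)) by ring.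
  rewrite ler_pM// -[s2 - v * qf _ t](subrK (s2 - v * T)) addrC.
  rewrite (le_trans (ler_normD _ _))// lerD2l.
  have -> : s2 - v * qf (B *m B) t - (s2 - v * T) = - (v * (qf (B *m B) t - T)) by ring.
  rewrite normrN; set y := v * _.
  have -> : v ^+ 2 * (qf (B *m B) t - T) ^+ 2 / eps = `|y| ^+ 2 / eps.
    by rewrite real_normK ?num_real// /y; ring.
  rewrite -(ler_pM2r eps0) mulrDl divfK ?gt_eqF//.
  by have := normr_ge0 y; nra.
rewrite RintegralD//; [|exact: tame_integrable|by apply: tame_integrable; exact: tameM].
rewrite gauss_cst RintegralZl//; last exact: tame_integrable.
rewrite gauss_qf_var; last by rewrite trmx_mul symB.
rewrite le_eqVlt; apply/orP; left; apply/eqP; field.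
by rewrite gt_eqF.
Qed.

End gaussian_moments.

(** * Stein's equation *)

Section stein_equation.
Context {R : realType}.
Local Notation RT := (measurableTypeR R).
Local Notation mu := (@lebesgue_measure R).
Variables (s : R) (s0 : s != 0).
Local Notation p := (@normal_pdf R 0 s).

Lemma normal_pdf_gt0 (x : R) : 0 < p x.
Proof. by rewrite normal_pdfE// mulr_gt0 ?normal_peak_gt0 ?expR_gt0. Qed.

Lemma normal_pdf_even (x : R) : p (- x) = p x.
Proof. by rewrite !normal_pdfE// /normal_fun !subr0 sqrrN. Qed.

Lemma normal_pdf_cvgy : p x @[x --> +oo] --> (0 : R).
Proof.
have c0 : 0 < (Num.sqrt (s ^+ 2 *+ 2))^-1.
  by rewrite invr_gt0 sqrtr_gt0 pmulrn_lgt0// exprn_even_gt0.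
have -> : p = (fun x => normal_peak s * gauss_fun (x * (Num.sqrt (s ^+ 2 *+ 2))^-1)).
  apply/funext => x; rewrite normal_pdfE// /normal_fun /gauss_fun subr0.
  by rewrite exprMn exprVn sqr_sqrtr ?mulrn_wge0 ?sqr_ge0// mulNr.
rewrite -[X in _ --> X](mulr0 (normal_peak s)); apply: cvgM; first exact: cvg_cst.
apply: (@cvg_comp _ _ _ (fun x : R => x * (Num.sqrt (s ^+ 2 *+ 2))^-1) gauss_fun).
  by apply: gt0_cvgMly => //; exact: cvg_id.
exact: cvg_gauss_fun.
Qed.

Lemma measurable_EFin_normal_pdf (D : set RT) : measurable_fun D (EFin \o p).
Proof. by apply/measurable_EFinP; apply: measurable_funTS; exact: measurable_normal_pdf. Qed.

Lemma integrable_normal_pdfS (D : set RT) : measurable D -> mu.-integrable D (EFin \o p).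
Proof. by move=> mD; apply: integrableS (integrable_normal_pdf 0 s). Qed.

(* Mills' bound: [x p(t) <= t p(t) = (- s^2 p)'(t)] for [t >= x]. *)
Lemma normal_tail (x : R) : 0 < x -> x * \int[mu]_(t in `[x, +oo[) p t <= s ^+ 2 * p x.
Proof.
move=> x0; have int_p : mu.-integrable `[x, +oo[ (EFin \o p) by exact: integrable_normal_pdfS.
rewrite -lee_fin EFinM /Rintegral fineK; last exact: integrable_fin_num.
have xtp t : x <= t -> 0 <= t * p t.
  by move=> xt; rewrite mulr_ge0 ?normal_pdf_ge0// (le_trans (ltW x0)).
have cp : continuous p by exact: continuous_normal_pdf.
have ctp : continuous (fun t : R => t * p t).
  by move=> t; apply: cvgM; [exact: cvg_id|exact: cp].
have dp (t : R) : is_derive t 1 (fun t : R => - (s ^+ 2 * p t)) (t * p t).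
  have dpt := is_derive_normal_pdf t s0.
  by apply: is_derive_eq; rewrite /GRing.scale/=; field.
have E : (\int[mu]_(t in `[x, +oo[) (t * p t)%:E = (s ^+ 2 * p x)%:E)%E.
  rewrite (@ge0_continuous_FTC2y _ (fun t => t * p t) (fun t => - (s ^+ 2 * p t)) x 0)//.
  - by rewrite sub0e -EFinN opprK.
  - exact: continuous_subspaceT.
  - have := cvgN (cvgM (@cvg_cst _ (s ^+ 2) _ (+oo : set_system R) _) normal_pdf_cvgy).
    by rewrite mulr0 oppr0 => c; exact: c.
  - by apply: cvg_at_right_filter; exact: is_derive_continuous (dp x).
  - by move=> t _; rewrite derive1E derive_val.
rewrite -E -ge0_integralZl//; last 3 first.
- exact: measurable_EFin_normal_pdf.
- by move=> t _; rewrite lee_fin normal_pdf_ge0.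
- by rewrite lee_fin ltW.
apply: ge0_le_integral => //.
- by move=> t _; rewrite -EFinM lee_fin mulr_ge0 ?normal_pdf_ge0 ?ltW.
- by apply: measurable_funeM; exact: measurable_EFin_normal_pdf.
- apply/measurable_EFinP; apply: measurable_funTS; exact: continuous_measurable_fun.
- move=> t; rewrite /= in_itv/= andbT => xt.
  by rewrite -EFinM lee_fin ler_wpM2r ?normal_pdf_ge0.
Qed.

(** The upper tail bound at [- x], transported by the reflection [t |-> - t], under which the
    density is invariant. *)
Lemma normal_lower_tail (x : R) : x < 0 ->
  - x * \int[mu]_(t in `]-oo, x]) p t <= s ^+ 2 * p x.
Proof.
move=> x0; have xN : 0 < - x by rewrite oppr_gt0.
have := normal_tail xN; rewrite normal_pdf_even; congr (_ * _ <= _).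
rewrite /Rintegral -[in RHS](opprK x) ge0_integration_by_substitutionNy.
- by congr fine; apply: eq_integral => t _; rewrite /= normal_pdf_even.
- by apply: continuous_subspaceT; exact: continuous_normal_pdf.
- by move=> t _; exact: normal_pdf_ge0.
Qed.

Variables (h : R -> R) (H : R).
Hypotheses (ch : continuous h) (hH : forall x, `|h x| <= H).

Let m := \int[normal_prob 0 s]_x h x.
Let k (x : R) := (h x - m) * p x.

Let int_h : (normal_prob 0 s).-integrable [set: RT] (EFin \o h).
Proof.
apply: (@le_integrable _ _ _ _ _ measurableT _ (EFin \o cst H)).
- by apply/measurable_EFinP; exact: continuous_measurable_fun.
- by move=> x _; rewrite lee_fin (le_trans (hH x))// ler_norm.
- exact: finite_measure_integrable_cst.
Qed.

Let mh : measurable_fun [set: RT] h.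
Proof. exact: continuous_measurable_fun. Qed.

Let int_hp : mu.-integrable setT (fun x => (h x * p x)%:E).
Proof. exact/integrable_normal_prob. Qed.

Let int_mp : mu.-integrable setT (fun x => (m * p x)%:E).
Proof. by under eq_fun do rewrite EFinM; apply: integrableZl => //; exact: integrable_normal_pdfS. Qed.

Let int_k : mu.-integrable setT (EFin \o k).
Proof.
have -> : EFin \o k = ((fun x => (h x * p x)%:E) \- (fun x => (m * p x)%:E))%E.
  by apply/funext => x; rewrite /k /= -EFinB mulrBl.
exact: integrableB.
Qed.

Let kint0 : \int[mu]_x k x = 0.
Proof.
transitivity (\int[mu]_x (h x * p x) - \int[mu]_x (m * p x)).
  by rewrite -RintegralB//; apply: eq_Rintegral => x _; rewrite /k mulrBl.
rewrite -Rintegral_normal_prob// RintegralZl//; last exact: integrable_normal_pdfS.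
by rewrite [X in _ * X]/Rintegral integral_normal_pdf mulr1 subrr.
Qed.

Let m_le : `|m| <= H.
Proof.
rewrite (le_trans (le_normr_Rintegral measurableT int_h))//.
have -> : H = \int[normal_prob 0 s]_x H.
  by rewrite Rintegral_cst// [X in fine X]probability_setT mulr1.
apply: le_Rintegral => //; first exact: (integrable_norm int_h).
exact: finite_measure_integrable_cst.
Qed.

Let k_le x : `|k x| <= 2 * H * p x.
Proof.
rewrite normrM (ger0_norm (normal_pdf_ge0 _ _ _)) ler_wpM2r ?normal_pdf_ge0//.
by rewrite (le_trans (ler_normB _ _))// mulr_natl mulr2n lerD.
Qed.

Let ck : continuous k.
Proof.
move=> x; apply: cvgM; last exact: continuous_normal_pdf.
by apply: cvgB; [exact: ch|exact: cvg_cst].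
Qed.

Let K (x : R) := \int[mu]_(t in `]-oo, x]) k t.

Let dK (x : R) : is_derive x 1 K (k x).
Proof.
have [] := @continuous_FTC1 _ k -oo%O x (x + 1) _ _ _ (@ck x); rewrite ?ltrDl//.
- exact: integrableS int_k.
- by rewrite ltNyr.
- by move=> dKx; rewrite derive1E => kx; apply: DeriveDef.
Qed.

Let norm_Rint_k (D : set RT) : measurable D ->
  `|\int[mu]_(t in D) k t| <= 2 * H * \int[mu]_(t in D) p t.
Proof.
move=> mD; have iD : mu.-integrable D (EFin \o k) by exact: integrableS int_k.
rewrite (le_trans (le_normr_Rintegral mD iD))//.
rewrite -RintegralZl//; last exact: integrable_normal_pdfS.
apply: le_Rintegral => //; first exact: (integrable_norm iD).
by have := integrableZl mD (2 * H) (integrable_normal_pdfS mD); exact: eq_integrable.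
Qed.

(** For [x < 0] the integral defining [K] runs over a lower tail. For [x > 0] the vanishing of the
    total integral of [k] rewrites [K x] as minus an integral over the upper tail. In both cases
    [|k| <= 2 H p] and the tail bounds apply. *)
Let K_le x : `|x * K x| <= 2 * H * (s ^+ 2 * p x).
Proof.
have H0 : 0 <= 2 * H by rewrite mulr_ge0// (le_trans _ (hH 0)).
rewrite normrM; case: (ltgtP x 0) => [x0|x0|->].
- rewrite ltr0_norm// (le_trans (ler_wpM2l _ (norm_Rint_k _)))//; first by rewrite oppr_ge0 ltW.
  by rewrite mulrCA ler_wpM2l// normal_lower_tail.
- have -> : K x = - \int[mu]_(t in `]x, +oo[) k t.
    apply/eqP; rewrite -subr_eq0 opprK -Rintegral_setU//.
    + by rewrite -itv_bndbnd_setU// set_itvE kint0.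
    + by rewrite -itv_bndbnd_setU// set_itvE.
    + by apply: lt_disjoint => a b; rewrite !in_itv/= andbT => /le_lt_trans; exact.
  rewrite normrN gtr0_norm// (le_trans (ler_wpM2l _ (norm_Rint_k _)))//; first exact: ltW.
  rewrite mulrCA ler_wpM2l// Rintegral_itv_obnd_cbnd; last exact: integrable_normal_pdfS.
  exact: normal_tail.
- by rewrite normr0 mul0r mulr_ge0// mulr_ge0 ?sqr_ge0 ?normal_pdf_ge0.
Qed.

(** Since [p' = - x p / s^2], the density is an integrating factor: the equation reads
    [s^2 (f p)' = (h - m) p], which gives [f = K / (s^2 p)]. *)
Lemma stein_solution : exists f f' : R -> R,
  [/\ forall x : R, is_derive x 1 f (f' x), continuous f',
      exists L, forall x, `|f' x| <= L &
      forall x, s ^+ 2 * f' x - x * f x = h x - \int[normal_prob 0 s]_x h x].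
Proof.
have p0 x : p x != 0 by rewrite gt_eqF// normal_pdf_gt0.
pose f x := K x / (s ^+ 2 * p x).
(* The derivative is written by solving the equation for it, so its continuity and boundedness
   reduce to those of [h] and [x f(x)]. *)
pose f' x := (h x - m + x * f x) / s ^+ 2.
have df (x : R) : is_derive x 1 f (f' x).
  have dpx := is_derive_normal_pdf x s0; have dKx := dK x.
  have sp0 : s ^+ 2 * p x != 0 by rewrite mulf_neq0 ?expf_neq0.
  have dV : is_derive x 1 (fun x => (s ^+ 2 * p x)^-1) (x / s ^+ 2 / (s ^+ 2 * p x)).
    have dsp : is_derive x 1 (fun x => s ^+ 2 * p x) (- (x * p x)).
      by apply: is_derive_eq; rewrite /GRing.scale/=; field.
    have -> : x / s ^+ 2 / (s ^+ 2 * p x) = - (s ^+ 2 * p x) ^- 2 *: - (x * p x).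
      by rewrite /GRing.scale/=; field; rewrite p0 s0.
    exact: (@is_deriveV _ (fun x => s ^+ 2 * p x) _ _ _ sp0 dsp).
  apply: is_derive_eq; rewrite /GRing.scale/= /f' /f /k.
  by field; rewrite p0 s0.
have cf : continuous f by move=> x; exact: is_derive_continuous (df x).
exists f, f'; split=> //.
- move=> x; apply: cvgM; last exact: cvg_cst.
  apply: cvgD; first by apply: cvgB; [exact: ch|exact: cvg_cst].
  by apply: cvgM; [exact: cvg_id|exact: cf].
- exists (4 * H / s ^+ 2) => x.
  have s2 : 0 < s ^+ 2 by rewrite exprn_even_gt0.
  rewrite normrM (gtr0_norm (_ : 0 < (s ^+ 2)^-1)) ?invr_gt0// ler_pM2r ?invr_gt0//.
  (* [h - m] contributes [H + H], and [x f(x)] contributes [2 H] by [K_le]. *)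
  have -> : 4 * H = (H + H) + 2 * H by ring.
  rewrite (le_trans (ler_normD _ _))// lerD//.
    by rewrite (le_trans (ler_normB _ _))// lerD.
  have sp : 0 < s ^+ 2 * p x by rewrite mulr_gt0 ?normal_pdf_gt0.
  by rewrite /f mulrA normrM normfV (gtr0_norm sp) ler_pdivrMr.
- by move=> x; rewrite /f' mulrCA divff ?expf_neq0// mulr1 addrK.
Qed.

End stein_equation.

(** * The uniform law on the sphere *)

Section lebesgue_scaling.
Context {R : realType}.
Local Notation RT := (measurableTypeR R).
Local Notation mu := (@lebesgue_measure R).

(** The image of Lebesgue measure under [x |-> r x], multiplied by [r], gives every interval []a,
    b]] its length, hence is Lebesgue measure by uniqueness. *)
Lemma ge0_lebesgue_integral_scale (r : R) (f : RT -> \bar R) : 0 < r ->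
  measurable_fun setT f -> (forall x, 0 <= f x)%E ->
  (\int[mu]_x f (r * x)%R = r^-1%:E * \int[mu]_x f x)%E.
Proof.
move=> r0 mf f0.
have mr : measurable_fun setT (fun x : RT => r * x : RT) by exact: measurable_funM.
unshelve epose (nu := [the {measure set RT -> \bar R} of
  pushforward mu (fun x : RT => r * x : RT)]); first exact: mr.
have E (A : set RT) : measurable A -> mu A = mscale (NngNum (ltW r0)) nu A.
  move=> mA; apply: lebesgue_measure_unique => // _ [[a b]] _ <-.
  change (mu `]a, b] = r%:E * mu ((fun x : RT => (r * x)%R) @^-1` `]a, b]%classic))%E.
  have -> : (fun x : RT => r * x) @^-1` `]a, b] = `]a / r, b / r]%classic.
    apply/seteqP; split => x /=; rewrite !in_itv/= ltr_pdivrMr// ler_pdivlMr// (mulrC x)//.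
  rewrite !lebesgue_measure_itv/= !lte_fin ltr_pM2r ?invr_gt0//.
  case: ifPn => _; last by rewrite mule0.
  by rewrite -EFinM mulrBr !(mulrC r) !divfK ?gt_eqF.
rewrite [in RHS](eq_measure_integral (mscale (NngNum (ltW r0)) nu)) => [|A mA _]; last exact: E.
rewrite ge0_integral_mscale//= muleA -EFinM mulVf ?gt_eqF// mul1e.
by rewrite ge0_integral_pushforward.
Qed.

End lebesgue_scaling.

(** * The Gaussian vector has a radial density *)

Section gauss_density.
Context {R : realType}.
Local Notation RT := (measurableTypeR R).
Local Open Scope ereal_scope.

Definition gauss_pdf n (t : n.-tuple RT) : R := (\prod_i normal_pdf 0 1 (tnth t i))%R.

Lemma gauss_pdf_cons n x (t : n.-tuple RT) :
  gauss_pdf (tuple_cons (x, t)) = (normal_pdf 0 1 x * gauss_pdf t)%R.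
Proof.
rewrite /gauss_pdf big_ord_recl; congr (_ * _)%R.
by apply: eq_bigr => i _; rewrite tnthS.
Qed.

(** The density depends on [t] only through [enorm t], so its superlevel sets are balls. *)
Lemma gauss_pdfE n (t : n.-tuple RT) :
  gauss_pdf t = (normal_peak 1 ^+ n * expR (- (enorm t ^+ 2 / 2)))%R.
Proof.
rewrite /gauss_pdf /enorm sqr_sqrtr; last by apply: sumr_ge0 => i _; exact: sqr_ge0.
under eq_bigr do rewrite normal_pdf01E.
rewrite big_split/= prodr_const card_ord -expR_sum; congr (_ * expR _)%R.
by rewrite mulr_suml -sumrN.
Qed.

Lemma gauss_pdf_ge0 n (t : n.-tuple RT) : (0 <= gauss_pdf t)%R.
Proof. by apply: prodr_ge0 => i _; exact: normal_pdf_ge0. Qed.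

Lemma measurable_gauss_pdf n : measurable_fun setT (@gauss_pdf n).
Proof.
apply: measurable_prod => i _; apply: measurableT_comp; first exact: measurable_normal_pdf.
exact: measurable_tnth.
Qed.

Lemma ge0_integral_gauss n (f : n.-tuple RT -> \bar R) :
  measurable_fun setT f -> (forall t, 0 <= f t) ->
  \int[gauss n]_t f t = \int[lebesgue_tuple n]_t (f t * (gauss_pdf t)%:E).
Proof.
elim: n f => [|n IHn] f mf f0.
  (* In dimension 0 both measures are the Dirac mass at the empty tuple, and the density is an empty
     product. *)
  apply: eq_integral => t _; rewrite /gauss_pdf big_ord0 mule1//.
have mc := @measurable_tuple_cons _ RT n.
have mfc x : measurable_fun setT (fun t => f (tuple_cons (x, t))).
  apply: (@measurableT_comp _ _ _ _ _ _ f) => //.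
  by apply: measurableT_comp; [exact: mc|exact: measurable_pair1].
have mfw : measurable_fun setT (fun p : RT * n.-tuple RT => f (tuple_cons p) * (gauss_pdf p.2)%:E).
  apply: emeasurable_funM; first exact: measurableT_comp.
  by apply/measurable_EFinP; apply: measurableT_comp; first exact: measurable_gauss_pdf.
rewrite /gauss /lebesgue_tuple !ge0_integral_power_measureS//; last 2 first.
- by apply: emeasurable_funM => //; apply/measurable_EFinP; exact: measurable_gauss_pdf.
- by move=> t; rewrite mule_ge0// lee_fin gauss_pdf_ge0.
under eq_integral do rewrite -/(gauss n) IHn//.
rewrite ge0_integral_normal_prob; first last.
- by move=> x; apply: integral_ge0 => t _; rewrite mule_ge0// lee_fin gauss_pdf_ge0.
- apply: (measurable_fun_fubini_tonelli_F (m2 := lebesgue_tuple n) _ mfw) => p.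
  by rewrite mule_ge0// lee_fin gauss_pdf_ge0.
apply: eq_integral => x _; rewrite -ge0_integralZr//.
- by apply: eq_integral => t _; rewrite gauss_pdf_cons -muleA -EFinM (mulrC (gauss_pdf t)).
- by apply: measurableT_comp mfw _; exact: measurable_pair1.
- by move=> t _; rewrite mule_ge0// lee_fin gauss_pdf_ge0.
- by rewrite lee_fin normal_pdf_ge0.
Qed.

End gauss_density.

(** * Cones, and the comparison of Gaussian and surface measure *)

Section cones.
Context {R : realType}.
Local Notation RT := (measurableTypeR R).
Local Notation mu := (@lebesgue_measure R).

Definition scale_tuple n (r : R) (t : n.-tuple RT) : n.-tuple RT :=
  [tuple (r * tnth t i : RT) | i < n].

Lemma scale_tuple_cons n (r x : R) (t : n.-tuple RT) :
  scale_tuple r (tuple_cons ((x : RT), t)) = tuple_cons ((r * x : RT), scale_tuple r t).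
Proof.
apply: eq_from_tnth => j; rewrite tnth_mktuple.
by case: (unliftP ord0 j) => [k ->|->]; rewrite ?tnthS ?tnth0// tnth_mktuple.
Qed.

Lemma measurable_scale_tuple n (r : R) : measurable_fun setT (@scale_tuple n r).
Proof.
apply/measurable_fun_tnthP => i.
rewrite (_ : _ \o _ = fun t : n.-tuple RT => r * tnth t i); last first.
  by apply/funext => t /=; rewrite tnth_mktuple.
by apply: measurable_funM => //; exact: measurable_tnth.
Qed.

Lemma ge0_lebesgue_tuple_scale n (r : R) (f : n.-tuple RT -> \bar R) : 0 < r ->
  measurable_fun setT f -> (forall t, 0 <= f t)%E ->
  (\int[lebesgue_tuple n]_t f (scale_tuple r t) =
   (r^-1 ^+ n)%:E * \int[lebesgue_tuple n]_t f t)%E.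
Proof.
move=> r0; elim: n f => [|n IHn] f mf f0.
  rewrite expr0 mul1e; apply: eq_integral => t _; congr f; by apply: eq_from_tnth => -[].
have mc := @measurable_tuple_cons _ RT n.
have mfc x : measurable_fun setT (fun t => f (tuple_cons (x, t))).
  apply: (@measurableT_comp _ _ _ _ _ _ f) => //.
  by apply: measurableT_comp; [exact: mc|exact: measurable_pair1].
have mFf : measurable_fun setT (fun x : RT => \int[lebesgue_tuple n]_t f (tuple_cons (x, t)))%E.
  apply: (measurable_fun_fubini_tonelli_F (m2 := lebesgue_tuple n) (f \o @tuple_cons _ RT n)) => //.
    exact: measurableT_comp.
  by move=> p; exact: f0.
have Ff0 x : (0 <= \int[lebesgue_tuple n]_t f (tuple_cons (x, t)))%E.
  by apply: integral_ge0 => t _; exact: f0.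
rewrite /lebesgue_tuple !ge0_integral_power_measureS//; last first.
  by apply: measurableT_comp => //; exact: measurable_scale_tuple.
transitivity (\int[mu]_x ((r^-1 ^+ n)%:E *
    \int[lebesgue_tuple n]_t f (tuple_cons ((r * x)%R : RT, t))))%E.
  apply: eq_integral => x _; rewrite -IHn//.
  by apply: eq_integral => t _; rewrite scale_tuple_cons.
have mr : measurable_fun setT (fun x : RT => r * x : RT) by exact: measurable_funM.
have rn0 : (0 <= (r^-1 ^+ n)%:E :> \bar R)%E by rewrite lee_fin exprn_ge0// invr_ge0 ltW.
pose g (x : RT) := (\int[lebesgue_tuple n]_t f (tuple_cons (x, t)))%E.
have -> : (\int[mu]_x ((r^-1 ^+ n)%:E * g (r * x)%R) =
    (r^-1 ^+ n)%:E * \int[mu]_x g (r * x)%R)%E.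
  apply: (ge0_integralZl mu measurableT (f := fun x : RT => g (r * x)%R)).
  - exact: (measurableT_comp mFf mr).
  - by move=> x _; exact: Ff0.
  - exact: rn0.
by rewrite (ge0_lebesgue_integral_scale r0 mFf Ff0) muleA -EFinM -exprSr.
Qed.

Lemma enorm_scale n (r : R) (t : n.-tuple RT) : 0 <= r ->
  enorm (scale_tuple r t) = r * enorm t.
Proof.
move=> r0; rewrite /enorm; under eq_bigr do rewrite tnth_mktuple exprMn.
by rewrite -mulr_sumr sqrtrM ?sqr_ge0// sqrtr_sqr ger0_norm.
Qed.

Lemma enorm_ge0 n (t : n.-tuple RT) : 0 <= enorm t. Proof. exact: sqrtr_ge0. Qed.

(** Preimages under [normalize] have this property; this is how sets on the sphere are lifted to the
    whole space. *)
Definition cone n (S : set (n.-tuple RT)) :=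
  forall r t, 0 < r -> S (scale_tuple r t) <-> S t.

Definition punctured_radius n (rho : R) : set (n.-tuple RT) := [set t | 0 < enorm t <= rho].

Lemma measurable_punctured_radius n rho : measurable (@punctured_radius n rho).
Proof.
rewrite (_ : @punctured_radius n rho = @enorm R n @^-1` `]0, rho]).
  by rewrite -[X in measurable X]setTI; apply: measurable_enorm.
by apply/seteqP; split => t /=; rewrite in_itv.
Qed.

(** The dilation by [rho^-1] carries the part of [S] of radius at most [rho] onto the part in the
    unit ball, because [S] is a cone. *)
Lemma lebesgue_cone n (S : set (n.-tuple RT)) (rho : R) : measurable S -> cone S -> 0 < rho ->
  (lebesgue_tuple n (S `&` @punctured_radius n rho) =
   (rho ^+ n)%:E * lebesgue_tuple n (S `&` @punctured_ball R n))%E.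
Proof.
move=> mS cS rho0; have rV : 0 < rho^-1 by rewrite invr_gt0.
have mB : measurable (S `&` @punctured_ball R n).
  by apply: measurableI => //; exact: measurable_punctured_ball.
have mBr : measurable (S `&` @punctured_radius n rho).
  by apply: measurableI => //; exact: measurable_punctured_radius.
have E (t : n.-tuple RT) : (S `&` @punctured_ball R n) (scale_tuple rho^-1 t) <->
    (S `&` @punctured_radius n rho) t.
  rewrite /setI /punctured_ball /punctured_radius /= enorm_scale ?(ltW rV)//.
  rewrite cS// mulrC pmulr_lgt0// ler_pdivrMr// mul1r.
  by [].
rewrite -[X in lebesgue_tuple n X]setIT -integral_indic//.
rewrite -[X in (_ * lebesgue_tuple n X)%E]setIT -integral_indic//.
rewrite -{2}(invrK rho) -ge0_lebesgue_tuple_scale//; last first.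
  by apply/measurable_EFinP; exact: measurable_indic.
apply: eq_integral => t _; rewrite !indicE; congr (_%:R%:E).
by congr nat_of_bool; apply/idP/idP; rewrite !inE => /E.
Qed.

(** The set lies in the product of [n] copies of the null set [[set 0]], of measure [0 ^+ n];
    positivity of [n] excludes [0 ^+ 0 = 1]. *)
Lemma gauss_origin n : (0 < n)%N -> gauss n [set t : n.-tuple RT | enorm t = 0] = 0%E.
Proof.
move=> n0; have m1 : measurable ([set 0] : set RT) by exact: measurable_set1.
have N0 : normal_prob (0 : R) 1 [set 0] = 0%E.
  apply: null_set_integral => //.
    by apply/measurable_EFinP; apply: measurable_funTS; exact: measurable_normal_pdf.
  exact: lebesgue_measure_set1.
have sub : [set t : n.-tuple RT | enorm t = 0] `<=` [set t | forall i, [set 0] (tnth t i)].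
  move=> t /= /eqP; rewrite sqrtr_eq0 => t0 i; apply/eqP.
  rewrite -sqrf_eq0 eq_le sqr_ge0 andbT (le_trans _ t0)//.
  by rewrite (bigD1 i)//= lerDl sumr_ge0// => j _; exact: sqr_ge0.
apply/eqP; rewrite eq_le measure_ge0 andbT.
apply: (@le_trans _ _ (gauss n [set t | forall i, [set 0] (tnth t i)])).
  apply: le_measure => //; rewrite inE; last exact: measurable_cube.
  have -> : [set t : n.-tuple RT | enorm t = 0] = @enorm R n @^-1` [set 0] by [].
  by rewrite -[X in measurable X]setTI; apply: measurable_enorm.
rewrite /gauss power_measure_cube// [X in (X ^+ _)%E]N0.
by case: n n0 {sub} => // n _; rewrite -EFin_expe expr0n.
Qed.

(** The region below the graph of the Gaussian density over [S]: its vertical sections have length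
    [gauss_pdf], its horizontal ones are [S] cut by balls. *)
Let layer n (S : set (n.-tuple RT)) : set (n.-tuple RT * RT) :=
  [set p | S p.1 /\ 0 < p.2 <= gauss_pdf p.1].

Let measurable_layer n (S : set (n.-tuple RT)) : measurable S -> measurable (layer S).
Proof.
move=> mS; have -> : layer S = (fst @^-1` S) `&`
    ((snd @^-1` `]0, +oo[) `&` [set p | p.2 <= gauss_pdf p.1]).
  apply/seteqP; split => -[t u] /=; rewrite in_itv/= andbT.
    by move=> [St /andP[]].
  by move=> [St [u0 uw]]; split=> //; apply/andP.
apply: measurableI; first by rewrite -[X in measurable X]setTI; exact: measurable_fst.
apply: measurableI; first by rewrite -[X in measurable X]setTI; exact: measurable_snd.
rewrite -[X in measurable X]setTI; apply: measurable_fun_le => //.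
by apply: measurableT_comp => //; exact: measurable_gauss_pdf.
Qed.

Let layer_slice n (S : set (n.-tuple RT)) u := [set t | layer S (t, u)].

Let measurable_layer_slice n (S : set (n.-tuple RT)) u : measurable S -> measurable (layer_slice S u).
Proof.
move=> mS; have -> : layer_slice S u = pair^~ u @^-1` layer S by [].
by rewrite -[X in measurable X]setTI; apply: measurable_pair2 => //; exact: measurable_layer.
Qed.

(** Tonelli on the region [layer S]: integrating the vertical sections gives the left side, the
    horizontal ones the right side. *)
Let gauss_layer n (S : set (n.-tuple RT)) : measurable S ->
  gauss n S = (\int[mu]_u lebesgue_tuple n (layer_slice S u))%E.
Proof.
move=> mS.
have mf : measurable_fun setT (fun p => (\1_(layer S) p)%:E : \bar R).
  by apply/measurable_EFinP; apply: measurable_indic; exact: measurable_layer.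
transitivity (\int[lebesgue_tuple n]_t \int[mu]_u (\1_(layer S) (t, u))%:E)%E.
  rewrite -[in LHS](setIT S) -integral_indic// ge0_integral_gauss//; last first.
    by apply/measurable_EFinP; exact: measurable_indic.
  apply: eq_integral => t _.
  transitivity (\int[mu]_u (\1_S t * \1_(`]0%R, gauss_pdf t]) u)%:E)%E.
    under eq_integral do rewrite EFinM.
    rewrite ge0_integralZl//; last first.
      by apply/measurable_EFinP; exact: measurable_indic.
    rewrite integral_indic//= setIT lebesgue_measure_itv/= lte_fin.
    congr (_ * _)%E; case: ltP; first by rewrite -EFinB subr0.
    by move=> w0; congr EFin; apply/eqP; rewrite eq_le w0 gauss_pdf_ge0.
  apply: eq_integral => u _; rewrite !indicE -natrM mulnb; congr (_%:R%:E).
  congr nat_of_bool; apply/andP/idP; rewrite !inE /layer /= in_itv/=; first by [].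
  by move=> [].
rewrite (fubini_tonelli (fun p => (\1_(layer S) p)%:E))//.
apply: eq_integral => u _; rewrite -[X in lebesgue_tuple n X]setIT -integral_indic//.
exact: measurable_layer_slice.
Qed.

(* The superlevel sets of the Gaussian density are balls, so the slices of two cones by such
   a set are in the same proportion as their intersections with the unit ball. *)
Let layer_slice_cone n (S T : set (n.-tuple RT)) u : measurable S -> measurable T ->
  cone S -> cone T -> S `<=` [set t | 0 < enorm t] -> T `<=` [set t | 0 < enorm t] ->
  (lebesgue_tuple n (layer_slice S u) * lebesgue_tuple n (T `&` @punctured_ball R n) =
   lebesgue_tuple n (layer_slice T u) * lebesgue_tuple n (S `&` @punctured_ball R n))%E.
Proof.
move=> mS mT cS cT S0 T0.
have c0 : 0 < normal_peak (1 : R) ^+ n by rewrite exprn_gt0// normal_peak_gt0.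
have [u0|u0] := ltP 0 u; last first.
  have E (Z : set (n.-tuple RT)) : layer_slice Z u = set0.
    by rewrite -subset0 => t [_ /=]; rewrite ltNge u0.
  by rewrite !E !measure0 !mul0e.
(* [q] is the squared radius of the ball on which the density is at least [u]. For [q <= 0] this
   ball is at most the origin, which [S] and [T] avoid. *)
pose q := 2 * ln (normal_peak 1 ^+ n / u) : R.
have wE (t : n.-tuple RT) : (u <= gauss_pdf t) = (enorm t ^+ 2 <= q).
  rewrite gauss_pdfE mulrC -ler_pdivrMr// -[X in X <= _]lnK ?posrE ?divr_gt0//.
  rewrite ler_expR -[X in ln X]invf_div lnV ?posrE ?divr_gt0// lerN2.
  by rewrite ler_pdivrMr// mulrC.
have [q0|q0] := ltP 0 q; last first.
  have E (Z : set (n.-tuple RT)) : Z `<=` [set t | 0 < enorm t] -> layer_slice Z u = set0.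
    move=> Z0; rewrite -subset0 => t [/= /Z0 /= t0 /andP[_]].
    by rewrite wE leNgt (le_lt_trans q0)// exprn_gt0.
  by rewrite !E// !measure0 !mul0e.
have E (Z : set (n.-tuple RT)) : Z `<=` [set t | 0 < enorm t] ->
    layer_slice Z u = Z `&` punctured_radius (Num.sqrt q).
  move=> Z0; apply/seteqP; split => t /=; rewrite /layer_slice /layer /punctured_radius /= wE u0/=.
    move=> [Zt tq]; split=> //; apply/andP; split; first exact: Z0.
    by move: tq; rewrite -[X in _ <= X](sqr_sqrtr (ltW q0)) ler_pXn2r ?nnegrE ?sqrtr_ge0 ?enorm_ge0.
  move=> [Zt /andP[_ tq]]; split=> //.
  by rewrite -(sqr_sqrtr (ltW q0)) lerXn2r ?nnegrE ?sqrtr_ge0 ?enorm_ge0.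
have sq0 : 0 < Num.sqrt q by rewrite sqrtr_gt0.
by rewrite (E _ S0) (E _ T0) (lebesgue_cone mS cS sq0) (lebesgue_cone mT cT sq0) muleAC.
Qed.

(** The proportion between the slices of [S] and those of the punctured space [P] is the same at
    every height; integrating over the height and using that [P] has Gaussian measure 1 gives the
    identity. Intersecting with [P] first removes the origin, a null set. *)
Lemma gauss_cone n (S : set (n.-tuple RT)) : (0 < n)%N -> measurable S -> cone S ->
  (gauss n S * lebesgue_tuple n (@punctured_ball R n) =
   lebesgue_tuple n (S `&` @punctured_ball R n))%E.
Proof.
move=> n0 mS cS.
pose P : set (n.-tuple RT) := [set t | 0 < enorm t].
have mP : measurable P.
  have -> : P = @enorm R n @^-1` `]0, +oo[ by apply/seteqP; split => t; rewrite /P /= in_itv/= andbT.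
  by rewrite -[X in measurable X]setTI; apply: measurable_enorm.
have cP : cone P by move=> r t r0; rewrite /P /= enorm_scale ?ltW// pmulr_rgt0.
have cSP : cone (S `&` P) by move=> r t r0; rewrite /setI /= cS// cP.
have mSP : measurable (S `&` P) by exact: measurableI.
have SPP : S `&` P `<=` P by move=> t [].
have PB : P `&` @punctured_ball R n = @punctured_ball R n.
  by apply/seteqP; split => t [] //= /andP[]//.
have mE0 : measurable [set t : n.-tuple RT | enorm t = 0].
  have -> : [set t : n.-tuple RT | enorm t = 0] = @enorm R n @^-1` [set 0] by [].
  by rewrite -[X in measurable X]setTI; apply: measurable_enorm.
have gP (Z : set (n.-tuple RT)) : measurable Z -> gauss n (Z `&` P) = gauss n Z.
  move=> mZ; have mZP : measurable (Z `&` P) by exact: measurableI.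
  apply/eqP; rewrite eq_le; apply/andP; split.
    by apply: le_measure; rewrite ?inE//; exact: subIsetl.
  apply: (@le_trans _ _ (gauss n ((Z `&` P) `|` [set t | enorm t = 0]))).
    apply: le_measure; rewrite ?inE//; first exact: measurableU.
    move=> t Zt; have [t0|t0] := ltP 0 (enorm t); [by left|right].
    by apply/eqP; rewrite eq_le t0 enorm_ge0.
  apply: le_trans (measureU2 _ _ _) _ => //.
  by rewrite [X in (_ + X)%E]gauss_origin// adde0.
have gTP : gauss n P = 1%E by rewrite -(setTI P) gP// gauss_setT.
rewrite -gP// gauss_layer//.
have mphi (Z : set (n.-tuple RT)) : measurable Z ->
    measurable_fun setT (fun u => lebesgue_tuple n (layer_slice Z u)).
  move=> mZ; have -> : (fun u => lebesgue_tuple n (layer_slice Z u)) =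
      fubini_G (lebesgue_tuple n) (fun p : n.-tuple RT * RT => (\1_(layer Z) p)%:E).
    apply/funext => u; rewrite /fubini_G -[X in lebesgue_tuple n X]setIT -integral_indic//.
    exact: measurable_layer_slice.
  apply: measurable_fun_fubini_tonelli_G => [|p]; last by rewrite lee_fin.
  by apply/measurable_EFinP; apply: measurable_indic; exact: measurable_layer.
rewrite -ge0_integralZr//; last exact: mphi.
under eq_integral do rewrite -{1}PB layer_slice_cone//.
rewrite ge0_integralZr//; last exact: mphi.
by rewrite -gauss_layer// gTP mul1e -setIA PB.
Qed.

Lemma normalize_scale n (t : n.-tuple RT) (r : R) : 0 < r ->
  normalize (scale_tuple r t) = normalize t.
Proof.
move=> r0; apply: eq_from_tnth => i; rewrite !tnth_mktuple enorm_scale ?ltW//.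
by rewrite invfM mulrACA divff ?gt_eqF// mul1r.
Qed.

Let normalization_cancel (k : R) (g l : \bar R) : g \is a fin_num ->
  (0 < k%:E * l)%E -> (k%:E * l < +oo)%E ->
  (k%:E * (g * l) * (fine (k%:E * l))^-1%:E)%E = g.
Proof.
move=> gfin kl0 kloo; rewrite muleCA -muleA.
have klf : (k%:E * l)%E \is a fin_num by rewrite gt0_fin_numE.
have fkl : fine (k%:E * l)%E != 0 by rewrite gt_eqF// fine_gt0// kl0.
by rewrite -{1}(fineK klf) -EFinM divff// mule1.
Qed.

(** The preimage of [E] is a cone, and its part in the punctured ball is exactly what
    [surface_measure] weighs; the dimension factor and the volume of the ball cancel in the
    normalization. *)
Lemma sphere_uniform_gauss n (E : set (n.+1.-tuple RT)) : measurable E ->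
  sphere_uniform n.+1 E = gauss n.+1 (@normalize R n.+1 @^-1` E).
Proof.
move=> mE; rewrite /sphere_uniform /= /mnormalize.
have sT0 := @surface_measure_gt0 R n; have sToo := @surface_measure_lty R n.+1.
(* The total mass is neither 0 nor infinite, so [mnormalize] does not fall back on its default
   measure. *)
rewrite ifF; last by apply/negP => /orP[] /eqP e; [rewrite e ltxx in sT0|rewrite e ltxx in sToo].
have mS : measurable (@normalize R n.+1 @^-1` E).
  by rewrite -[X in measurable X]setTI; apply: measurable_normalize.
have cS : cone (@normalize R n.+1 @^-1` E).
  by move=> r t r0; rewrite /preimage /= normalize_scale.
have gfin : gauss n.+1 (@normalize R n.+1 @^-1` E) \is a fin_num.
  rewrite ge0_fin_numE// (@le_lt_trans _ _ 1%E) ?ltry// -(gauss_setT n.+1).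
  by apply: le_measure; rewrite ?inE.
move: sT0 sToo; rewrite /surface_measure preimage_setT setTI => sT0 sToo.
transitivity ((n.+1%:R%:E * lebesgue_tuple n.+1 ((@normalize R n.+1 @^-1` E) `&` @punctured_ball R n.+1)) *
    (fine (n.+1%:R%:E * lebesgue_tuple n.+1 (@punctured_ball R n.+1)))^-1%:E)%E.
  by rewrite -[X in fine (_ * lebesgue_tuple _ X)]setTI.
rewrite -(gauss_cone (ltn0Sn n) mS cS).
exact: normalization_cancel.
Qed.

Lemma integral_sphere_uniform n (f : n.+1.-tuple RT -> R) (C : R) :
  measurable_fun setT f -> (forall t, `|f t| <= C) ->
  \int[sphere_uniform n.+1]_t f t = \int[gauss n.+1]_t f (normalize t).
Proof.
move=> mf fC; have mn := @measurable_normalize R n.+1.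
rewrite /Rintegral; congr fine.
rewrite [LHS](eq_measure_integral (pushforward (gauss n.+1) (@normalize R n.+1))) => [|A mA _]; last first.
  exact: sphere_uniform_gauss.
rewrite integral_pushforward//; first exact/measurable_EFinP.
rewrite preimage_setT; apply: tame_integrable; split; first exact: measurableT_comp.
by exists 0%N, C => t; rewrite expr0 mulr1.
Qed.

End cones.

(** * Complex matrices as real matrices *)

Section realification.
Context {R : realType}.
Local Notation RT := (measurableTypeR R).
Local Open Scope sesquilinear_scope.
Local Notation Re := (@complex.Re R).
Local Notation Im := (@complex.Im R).

Definition realify m (A : 'M[R[i]]_m) : 'M[R]_(m + m) :=
  block_mx (map_mx Re A) (- map_mx Im A) (map_mx Im A) (map_mx Re A).

Lemma realifyM m (A B : 'M[R[i]]_m) : realify (A *m B) = realify A *m realify B.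
Proof.
rewrite /realify mulmx_block.
have ReM : map_mx Re (A *m B) = map_mx Re A *m map_mx Re B - map_mx Im A *m map_mx Im B.
  apply/matrixP => i j; rewrite !mxE raddf_sum/= -sumrB; apply: eq_bigr => k _.
  by rewrite !mxE; case: (A i k) => ? ?; case: (B k j).
have ImM : map_mx Im (A *m B) = map_mx Re A *m map_mx Im B + map_mx Im A *m map_mx Re B.
  apply/matrixP => i j; rewrite !mxE raddf_sum/= -big_split; apply: eq_bigr => k _.
  by rewrite !mxE; case: (A i k) => ? ?; case: (B k j) => ? ? /=; rewrite mulrC.
rewrite ReM ImM !mulNmx !mulmxN; congr block_mx.
- by rewrite opprD.
- by rewrite addrC.
- by rewrite addrC.
Qed.

Lemma mxtrace_realify m (A : 'M[R[i]]_m) : \tr (realify A) = 2 * Re (\tr A).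
Proof.
rewrite /realify mxtrace_block mulr_natl mulr2n /mxtrace raddf_sum/=.
by congr (_ + _); apply: eq_bigr => i _; rewrite mxE.
Qed.

Lemma trmx_realify m (A : 'M[R[i]]_m) : A \is hermsymmx -> (realify A)^T = realify A.
Proof.
move=> /is_hermitianmxP; rewrite expr0 scale1r => hA.
have hij i j : A i j = (A j i)^* by rewrite {1}hA !mxE.
rewrite /realify tr_block_mx; congr block_mx; apply/matrixP => i j; rewrite !mxE hij;
  by case: (A i j) => ? ? //=; rewrite ?opprK.
Qed.

Lemma cvec_lin m (A : 'M[R[i]]_m) (t : (m + m).-tuple RT) :
  cvec [tuple (lin (realify A) t i : RT) | i < m + m] = A *m cvec t.
Proof.
apply/matrixP => i j; rewrite !mxE !tnth_mktuple /lin.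
apply/eqP; rewrite eq_complex /= !raddf_sum/= !big_split_ord/= -!big_split/=.
apply/andP; split; apply/eqP; apply: eq_bigr => k _.
  by rewrite block_mxEul block_mxEur !mxE; case: (A i k) => ? ?; rewrite /= mulNr.
rewrite block_mxEdl block_mxEdr !mxE; case: (A i k) => ? ?; rewrite /= addrC//.
Qed.

Lemma sum_lin_sqr_cnorm m (A : 'M[R[i]]_m) (t : (m + m).-tuple RT) :
  \sum_i lin (realify A) t i ^+ 2 = cnorm (A *m cvec t) ^+ 2.
Proof.
rewrite -cvec_lin cnorm_cvec /enorm sqr_sqrtr; last by apply: sumr_ge0 => i _; exact: sqr_ge0.
by apply: eq_bigr => i _; rewrite tnth_mktuple.
Qed.

Lemma qf_realify m (A : 'M[R[i]]_m) (t : (m + m).-tuple RT) :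
  qf (realify A) t = numerical_fun A t.
Proof.
rewrite /numerical_fun -cvec_lin /inner !mxE raddf_sum/= /qf big_split_ord/= -big_split/=.
by apply: eq_bigr => k _; rewrite !mxE !tnth_mktuple /= mulNr opprK.
Qed.

Lemma cvec_surj m (x : 'cV[R[i]]_m) : exists t : (m + m).-tuple RT, x = cvec t.
Proof.
exists [tuple (match fintype.split j with inl k => Re (x k 0) | inr k => Im (x k 0) end : RT) | j < m + m].
apply/matrixP => i j; rewrite ord1 !mxE !tnth_mktuple.
by rewrite -/(unsplit (inl i)) unsplitK -/(unsplit (inr i)) unsplitK; case: (x i 0).
Qed.

Lemma norm_tnth_le m (t : m.-tuple RT) i : `|tnth t i : R| <= enorm t.
Proof.
rewrite -sqrtr_sqr ler_sqrt; last by apply: sumr_ge0 => j _; exact: sqr_ge0.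
by rewrite (bigD1 i)//= lerDl sumr_ge0// => j _; exact: sqr_ge0.
Qed.

(** Needed before [sup] can be used as an upper bound. The coordinates of a unit vector are at most
    1 in absolute value, so each row is bounded by the sum of its absolute entries. *)
Lemma opnorm_has_ubound m (A : 'M[R[i]]_m) :
  has_ubound [set cnorm (A *m x) | x in [set x : 'cV[R[i]]_m | cnorm x = 1]].
Proof.
exists (Num.sqrt (\sum_i (\sum_j `|realify A i j|) ^+ 2)) => _ [x /= x1 <-].
have [t tE] := cvec_surj x; rewrite tE cnorm_cvec in x1 *.
have S0 : 0 <= \sum_i (\sum_j `|realify A i j|) ^+ 2 by apply: sumr_ge0 => i _; exact: sqr_ge0.
rewrite -[leLHS]ger0_norm ?sqrtr_ge0// -sqrtr_sqr ler_sqrt// -sum_lin_sqr_cnorm.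
apply: ler_sum => i _; rewrite -[leLHS]real_normK ?num_real// lerXn2r ?nnegrE//.
  by apply: sumr_ge0.
rewrite (le_trans (ler_norm_sum _ _ _))//; apply: ler_sum => j _.
by rewrite normrM ler_piMr// -x1 norm_tnth_le.
Qed.

Lemma opnorm_ge0 m (A : 'M[R[i]]_m) : 0 <= opnorm A.
Proof.
(* If there is no unit vector, the norm is the supremum of the empty set, which is 0. *)
have [[_ [x x1 _]]|/set0P/negP/negPn/eqP] := pselect
    ([set cnorm (A *m x) | x in [set x : 'cV[R[i]]_m | cnorm x = 1]] !=set0).
  apply: (@le_trans _ _ (cnorm (A *m x))); first exact: sqrtr_ge0.
  by apply: ub_le_sup; [exact: opnorm_has_ubound|exists x].
by rewrite /opnorm => ->; rewrite sup0.
Qed.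

(** By homogeneity it is enough to consider the unit vector [t / |t|]; the zero vector is treated
    apart. *)
Lemma sum_lin_sqr_le m (A : 'M[R[i]]_m) (t : (m + m).-tuple RT) :
  \sum_i lin (realify A) t i ^+ 2 <= opnorm A ^+ 2 * \sum_i tnth t i ^+ 2.
Proof.
have S0 : 0 <= \sum_i (tnth t i : R) ^+ 2 by apply: sumr_ge0 => i _; exact: sqr_ge0.
have : 0 <= enorm t by exact: sqrtr_ge0.
rewrite le_eqVlt => /predU1P[t0|t0].
  have ti i : tnth t i = 0 :> R by apply/eqP; rewrite -normr_le0 t0 norm_tnth_le.
  rewrite big1 => [|i _]; first by apply: mulr_ge0 => //; exact: sqr_ge0.
  by rewrite /lin big1 ?expr0n// => j _; rewrite ti mulr0.
have eE : enorm t ^+ 2 = \sum_i (tnth t i : R) ^+ 2 by rewrite sqr_sqrtr.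
pose u := [tuple (tnth t i / enorm t : RT) | i < m + m].
have uE : enorm u = 1.
  rewrite /enorm; under eq_bigr do rewrite tnth_mktuple exprMn.
  by rewrite -mulr_suml -eE -exprMn divff ?gt_eqF// expr1n sqrtr1.
have linE i : lin (realify A) t i = enorm t * lin (realify A) u i.
  rewrite /lin mulr_sumr; apply: eq_bigr => j _; rewrite tnth_mktuple.
  by field; rewrite gt_eqF.
under eq_bigr do rewrite linE exprMn.
rewrite -mulr_sumr sum_lin_sqr_cnorm -eE mulrC ler_wpM2r ?sqr_ge0//.
rewrite lerXn2r ?nnegrE ?sqrtr_ge0//.
  exact: opnorm_ge0.
by apply: ub_le_sup; [exact: opnorm_has_ubound|exists (cvec u) => //=; rewrite cnorm_cvec].
Qed.

(** For symmetric [C], the trace of [C *m C] is the sum of the squared norms of its columns. The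
    columns of [B *m B] are the images under [B] of the columns of [B], so the norm bound applies
    column by column. *)
Lemma mxtrace_pow4_le m (A : 'M[R[i]]_m) (B := realify A) : B^T = B ->
  \tr ((B *m B) *m (B *m B)) <= opnorm A ^+ 2 * \tr (B *m B).
Proof.
move=> symB.
have trE (C : 'M[R]_(m + m)) : C^T = C -> \tr (C *m C) = \sum_j \sum_i C i j ^+ 2.
  move=> symC; rewrite /mxtrace exchange_big/=; apply: eq_bigr => i _.
  rewrite mxE; apply: eq_bigr => j _.
  by rewrite -{2}symC mxE expr2.
rewrite !trE ?trmx_mul ?symB// mulr_sumr; apply: ler_sum => j _.
have := sum_lin_sqr_le A [tuple (B i j : RT) | i < m + m].
under [X in _ <= _ * X -> _]eq_bigr do rewrite tnth_mktuple.
apply: le_trans; rewrite le_eqVlt; apply/orP; left; apply/eqP; apply: eq_bigr => i _.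
by rewrite mxE; congr (_ ^+ 2); apply: eq_bigr => k _; rewrite tnth_mktuple.
Qed.

End realification.

(** * Convergence *)

Section slutsky.
Context {R : realType}.

(** Uniform continuity in which only [x] is confined to [[-K, K]]: in the application [y = w / v]
    may leave this interval. *)
Lemma heine_cantor_itv (h : R -> R) (K e : R) : continuous h -> 0 < e ->
  exists2 d : R, 0 < d & forall x y : R, `|x| <= K -> `|x - y| < d -> `|h x - h y| <= e.
Proof.
move=> ch e0.
have /compact_near_coveringP cov : compact (`[- K, K]%classic : set R) by exact: segment_compact.
have : \forall d \near (0 : R)^'+, `[- K, K]%classic `<=`
    [set x | forall y : R, `|x - y| < d -> `|h x - h y| <= e].
  apply: (cov _ _ (fun d x => forall y : R, `|x - y| < d -> `|h x - h y| <= e)) => x _.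
  have := ch x => /cvgrPdist_lt /(_ (e / 2)).
  rewrite divr_gt0// => /(_ isT) /nbhs_ballP[r /= r0 hr].
  have r2 : 0 < r / 2 by rewrite divr_gt0.
  exists (ball x (r / 2), [set d | d < r / 2]) => /=.
    by split; [exact: nbhsx_ballx|exact: nbhs_right_lt].
  move=> [z d] /= [xz dr] y zy.
  rewrite /ball/= in xz.
  have hz : `|h x - h z| < e / 2 by apply: hr; rewrite /ball/=; lra.
  have hy : `|h x - h y| < e / 2.
    apply: hr; rewrite /ball/= (le_lt_trans (ler_distD z _ _))//; lra.
  rewrite (le_trans (ler_distD (h x) _ _))// (distrC (h z)); lra.
move=> hd; near (0 : R)^'+ => d.
exists d => [|x y xK xy]; first by near: d; exact: nbhs_right_gt.
have : `[- K, K]%classic `<=` [set x | forall y : R, `|x - y| < d -> `|h x - h y| <= e].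
  by near: d; exact: hd.
by apply=> //=; rewrite in_itv/= -ler_norml.
Unshelve. all: by end_near. Qed.

(* Either [|w| <= K] and [v] is close to [1], and uniform continuity applies, or the
   right-hand side exceeds [2 H]. *)
Lemma slutsky_pointwise (h : R -> R) (H K e : R) : continuous h ->
  (forall x, `|h x| <= H) -> 0 < K -> 0 < e ->
  exists2 eta : R, 0 < eta & forall w v : R,
    `|h (w / v) - h w| <= e + 2 * H * (w ^+ 2 / K ^+ 2 + (v - 1) ^+ 2 / eta ^+ 2).
Proof.
move=> ch hH K0 e0; have H0 : 0 <= H by rewrite (le_trans _ (hH 0)).
have [d d0 hd] := heine_cantor_itv K ch e0.
(* [|v - 1| <= 1/2] forces [v >= 1/2]; then [|w - w/v| = |w| |v - 1| / v] is at most
   [K * 2 * d / (4 K) = d/2 < d]. *)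
pose eta := Num.min (1 / 2) (d / (4 * K)).
have eta0 : 0 < eta by rewrite lt_min !divr_gt0// mulr_gt0.
exists eta => // w v.
have q1 : 0 <= w ^+ 2 / K ^+ 2 by rewrite divr_ge0 ?sqr_ge0.
have q2 : 0 <= (v - 1) ^+ 2 / eta ^+ 2 by rewrite divr_ge0 ?sqr_ge0.
have big : 1 <= w ^+ 2 / K ^+ 2 + (v - 1) ^+ 2 / eta ^+ 2 ->
    `|h (w / v) - h w| <= e + 2 * H * (w ^+ 2 / K ^+ 2 + (v - 1) ^+ 2 / eta ^+ 2).
  move=> q; have := hH (w / v); have := hH w => hw hv.
  rewrite (le_trans (ler_normB _ _))// (@le_trans _ _ (2 * H))//; first by lra.
  by rewrite -[leLHS]add0r lerD//; [exact: ltW|rewrite ler_peMr// mulr_ge0].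
have ratio (x y : R) : 0 < y -> y < `|x| -> 1 <= x ^+ 2 / y ^+ 2.
  move=> y0 yx; rewrite ler_pdivlMr ?exprn_gt0// mul1r -(real_normK (num_real x)).
  by rewrite lerXn2r ?nnegrE//; exact: ltW.
have [wK|wK] := leP `|w| K; last first.
  by apply: big; rewrite -[leLHS]addr0 lerD// ratio.
have [ve|ve] := leP `|v - 1| eta; last first.
  by apply: big; rewrite -[leLHS]add0r lerD// ratio.
apply: le_trans (_ : e <= _); last by rewrite lerDl mulr_ge0 ?addr_ge0// mulr_ge0.
have eta2 : eta <= 1 / 2 by rewrite ge_min lexx.
have etad : eta <= d / (4 * K) by rewrite ge_min lexx orbT.
have v2 : 1 / 2 <= v by move: ve; rewrite ler_norml => /andP[? ?]; lra.
have v0 : 0 < v by rewrite (lt_le_trans _ v2)// divr_gt0.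
rewrite distrC; apply: hd => //.
have -> : w - w / v = w * ((v - 1) / v) by field; rewrite gt_eqF.
rewrite normrM normf_div (gtr0_norm v0).
have q : `|v - 1| / v <= d / (2 * K).
  rewrite ler_pdivrMr//; apply: le_trans ve _; apply: le_trans etad _.
  have -> : d / (4 * K) = d / (2 * K) * (1 / 2) by field; rewrite gt_eqF.
  by rewrite ler_wpM2l// divr_ge0 ?ltW// mulr_gt0.
apply: le_lt_trans (_ : K * (d / (2 * K)) < _); first by rewrite ler_pM// divr_ge0// ltW.
have -> : K * (d / (2 * K)) = d / 2 by field; rewrite gt_eqF.
by lra.
Qed.

End slutsky.

(** * The quantitative bound for a fixed matrix *)

Section numerical_measure_bound.
Context {R : realType}.
Local Notation RT := (measurableTypeR R).

Lemma numerical_funZ n (c : R) (A : 'M[R[i]]_n) t :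
  numerical_fun (real_complex R c *: A) t = c * numerical_fun A t.
Proof.
rewrite /numerical_fun /inner -scalemxAl -scalemxAr mxE.
by case: (_ 0 0) => a b /=; rewrite mul0r subr0.
Qed.

Lemma lin_normalize n (B : 'M[R]_n) (t : n.-tuple RT) i : lin B (normalize t) i = lin B t i / enorm t.
Proof. by rewrite /lin mulr_suml; apply: eq_bigr => j _; rewrite tnth_mktuple mulrA. Qed.

Lemma qf_normalize n (B : 'M[R]_n) (t : n.-tuple RT) : qf B (normalize t) = qf B t / enorm t ^+ 2.
Proof.
rewrite /qf mulr_suml; apply: eq_bigr => j _.
by rewrite lin_normalize tnth_mktuple mulrACA -invfM expr2.
Qed.

(** With [|t|^2] seen as a quadratic form, its concentration is one more instance of
    [gauss_qf_var]. *)
Lemma qf1 n (t : n.-tuple RT) : qf 1%:M t = enorm t ^+ 2.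
Proof.
rewrite /enorm sqr_sqrtr; last by apply: sumr_ge0 => i _; exact: sqr_ge0.
apply: eq_bigr => i _; rewrite /lin (bigD1 i)//= mxE eqxx mul1r big1 ?addr0 ?expr2// => j ji.
by rewrite mxE eq_sym (negbTE ji) mul0r.
Qed.

Lemma Rintegral_numerical_measure n (A : 'M[R[i]]_n.+1) (h : R -> R) (H : R) :
  continuous h -> (forall x, `|h x| <= H) ->
  \int[numerical_measure A]_x h x =
  \int[gauss (n.+1 + n.+1)]_t h (qf (realify A) t / enorm t ^+ 2).
Proof.
move=> ch hH.
have mh : measurable_fun [set: RT] h by exact: continuous_measurable_fun.
have mnf := measurable_numerical_fun A.
transitivity (\int[sphere_uniform (n.+1 + n.+1)]_t h (numerical_fun A t)).
  rewrite /Rintegral /numerical_measure /distribution integral_pushforward//.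
    exact/measurable_EFinP.
  apply: (@le_integrable _ _ _ _ _ measurableT _ (EFin \o cst H)).
  - by apply/measurable_EFinP; exact: measurableT_comp.
  - by move=> x _; rewrite lee_fin (le_trans (hH _))// ler_norm.
  - exact: finite_measure_integrable_cst.
(* [n.+1 + n.+1] computes to [(n + n.+1).+1], the successor shape that the lemma expects. *)
rewrite (@integral_sphere_uniform R (n + n.+1) (h \o numerical_fun A) H); first last.
- by move=> t; exact: hH.
- exact: (measurableT_comp mh mnf).
by apply: eq_Rintegral => t _; rewrite /= -qf_realify qf_normalize.
Qed.

(** The first error, with [e], is the cost of replacing [w / v] by [w], averaged through the second
    moments [E w^2 = a] and [E (v - 1)^2 = 2 / N]. The second, with factor [L], is [gauss_stein],
    the trace of [B^4] being bounded by the norm of [A]. *)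
Lemma numerical_measure_normal n (A : 'M[R[i]]_n.+1) (s : R) (h f f' : R -> R)
    (H K e eta eps L : R) (N := (n.+1 + n.+1)%:R : R) (a := complex.Re (\tr (A *m A)) / n.+1%:R) :
  A \is hermsymmx -> \tr A = 0 -> continuous h -> (forall x, `|h x| <= H) ->
  0 < K -> 0 < eta -> 0 < eps ->
  (forall w v, `|h (w / v) - h w| <= e + 2 * H * (w ^+ 2 / K ^+ 2 + (v - 1) ^+ 2 / eta ^+ 2)) ->
  (forall x : R, is_derive x 1 f (f' x)) -> continuous f' -> (forall x, `|f' x| <= L) ->
  (forall x, s ^+ 2 * f' x - x * f x = h x - \int[normal_prob 0 s]_x h x) ->
  `|\int[numerical_measure (real_complex R (Num.sqrt n.+1%:R) *: A)]_x h x -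
    \int[normal_prob 0 s]_x h x| <=
  e + 2 * H * (a / K ^+ 2 + 2 / N / eta ^+ 2) +
  L * (`|s ^+ 2 - a| + eps + 2 * (opnorm A ^+ 2 / N * a) / eps).
Proof.
move=> hermA trA ch hH K0 eta0 eps0 hsl df cf' f'L stein.
set B := realify A; set M := (n.+1 + n.+1)%N.
have symB : B^T = B by exact: trmx_realify.
have trB : \tr B = 0 by rewrite mxtrace_realify trA mulr0.
have n0 : n.+1%:R != 0 :> R by rewrite pnatr_eq0.
have NE : N = 2 * n.+1%:R by rewrite /N natrD mulr_natl mulr2n.
have N0 : 0 < N by rewrite ltr0n.
have aE : \tr (B *m B) / N = a.
  by rewrite /B -realifyM mxtrace_realify NE /a; field.
(* This scaling makes [w = c <B t, t>] the variable [W], and [2 c^2 = 1/N] makes its variance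
   [tr B^2 / N = a]. *)
pose c := Num.sqrt n.+1%:R / N.
have c2 : 2 * c ^+ 2 = N^-1.
  by rewrite exprMn sqr_sqrtr// exprVn NE; field.
have mh : measurable_fun [set: RT] h by exact: continuous_measurable_fun.
have tB := tame_qf B; have tI := @tame_qf R M 1%:M.
have tc (k : R) : tame (fun _ : M.-tuple RT => k) by exact: tame_cst.
have tS (g : M.-tuple RT -> R) : tame g -> tame (fun t => g t ^+ 2).
  by move=> tg; under eq_fun do rewrite expr2; exact: tameM.
pose w (t : M.-tuple RT) := c * qf B t; pose v (t : M.-tuple RT) := N^-1 * qf 1%:M t.
have tw : tame w by exact: tameM.
have tv : tame v by exact: tameM.
have th g : measurable_fun setT g -> tame (fun t : M.-tuple RT => h (g t)).
  move=> mg; split; first exact: measurableT_comp.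
  by exists 0%N, H => t; rewrite expr0 mulr1.
have thw : tame (fun t => h (w t)) by apply: th; exact: tame_measurable tw.
have WE t : Num.sqrt n.+1%:R * (qf B t / enorm t ^+ 2) = w t / v t.
  rewrite /w /v /c qf1; move: (qf B t) (enorm t ^+ 2) => q E.
  (* [E^-1] is generalized before [field], so the identity also covers [t = 0], where both sides are
     0. *)
  by rewrite invfM invrK; move: E^-1 => F; field; rewrite gt_eqF.
have mwv : measurable_fun setT (fun t => w t / v t).
  have -> : (fun t => w t / v t) = (fun t => Num.sqrt n.+1%:R * qf B (@normalize R M t)).
    by apply/funext => t; rewrite -WE qf_normalize.
  apply: measurable_funM => //; apply: measurableT_comp; last exact: measurable_normalize.
  exact: tame_measurable tB.
have thwv : tame (fun t => h (w t / v t)) by exact: th.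
have -> : \int[numerical_measure (real_complex R (Num.sqrt n.+1%:R) *: A)]_x h x =
    \int[gauss M]_t h (w t / v t).
  rewrite (Rintegral_numerical_measure _ ch hH); apply: eq_Rintegral => t _.
  by rewrite -WE qf_realify numerical_funZ -qf_realify mulrA.
set m := \int[normal_prob 0 s]_x h x.
have int_w2 : \int[gauss M]_t (w t ^+ 2) = a.
  transitivity (\int[gauss M]_t (c ^+ 2 * (qf B t - \tr B) ^+ 2)).
    by apply: eq_Rintegral => t _; rewrite /w trB subr0 exprMn.
  rewrite RintegralZl//; last by apply: tame_integrable; apply: tS; exact: tameD.
  by rewrite gauss_qf_var// mulrA (mulrC _ 2) c2 mulrC aE.
have int_v2 : \int[gauss M]_t ((v t - 1) ^+ 2) = 2 / N.
  transitivity (\int[gauss M]_t (N^-1 ^+ 2 * (qf 1%:M t - \tr (1%:M : 'M[R]_M)) ^+ 2)).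
    apply: eq_Rintegral => t _; rewrite /v mxtrace1 -exprMn -/N mulrBr mulVf ?gt_eqF//.
  rewrite RintegralZl//; last by apply: tame_integrable; apply: tS; exact: tameD.
  rewrite gauss_qf_var ?trmx1// mulmx1 mxtrace1 -/N; field.
  by rewrite gt_eqF.
(* The integral of [h (w t)] is inserted; Stein's equation turns its distance to [m] into the
   integral bounded by [gauss_stein]. *)
have -> : \int[gauss M]_t h (w t / v t) - m =
    \int[gauss M]_t (h (w t / v t) - h (w t)) + (\int[gauss M]_t (s ^+ 2 * f' (w t) - w t * f (w t))).
  have -> : \int[gauss M]_t (s ^+ 2 * f' (w t) - w t * f (w t)) = \int[gauss M]_t h (w t) - m.
    rewrite -[X in _ = _ - X](gauss_cst M m) -RintegralB//; [|exact: tame_integrable..].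
    by apply: eq_Rintegral => t _; exact: stein.
  by rewrite RintegralB//; [ring|exact: tame_integrable..].
have tdiff : tame (fun t => h (w t / v t) - h (w t)).
  by under eq_fun do rewrite -mulN1r; apply: tameD => //; exact: tameM.
have tw2 := tS _ tw.
have tv2 : tame (fun t => (v t - 1) ^+ 2) by apply: tS; exact: tameD.
rewrite (le_trans (ler_normD _ _))// lerD//.
  apply: le_trans (le_normr_Rintegral measurableT (tame_integrable tdiff)) _.
  apply: le_trans (gauss_le (G := fun t =>
    e + (2 * H / K ^+ 2 * w t ^+ 2 + 2 * H / eta ^+ 2 * (v t - 1) ^+ 2)) _ _ _) _.
  - exact: tame_norm.
  - by apply: tameD => //; apply: tameD; exact: tameM.
  - move=> t; rewrite (le_trans (hsl _ _))//.
    rewrite le_eqVlt; apply/orP; left; apply/eqP; ring.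
  have t1 : tame (fun t => 2 * H / K ^+ 2 * w t ^+ 2) by exact: tameM.
  have t2 : tame (fun t => 2 * H / eta ^+ 2 * (v t - 1) ^+ 2) by exact: tameM.
  rewrite RintegralD//; [|exact: tame_integrable|by apply: tame_integrable; exact: tameD].
  rewrite RintegralD//; [|exact: tame_integrable..].
  rewrite gauss_cst !RintegralZl//; [|exact: tame_integrable..].
  rewrite int_w2 int_v2 le_eqVlt; apply/orP; left; apply/eqP; ring.
apply: le_trans (gauss_stein c (s ^+ 2) symB trB eps0 df cf' f'L) _.
have L0 : 0 <= L by rewrite (le_trans _ (f'L 0)).
rewrite ler_wpM2l// c2 [X in s ^+ 2 - X]mulrC aE lerD2l.
rewrite ler_pM2r ?invr_gt0// -mulrA ler_pM2l// -aE.
have -> : opnorm A ^+ 2 / N * (\tr (B *m B) / N) = N^-1 ^+ 2 * (opnorm A ^+ 2 * \tr (B *m B)) by ring.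
by rewrite ler_wpM2l ?sqr_ge0// mxtrace_pow4_le.
Qed.

End numerical_measure_bound.

(** * Passage to the limit *)

Section limits.
Context {R : realType}.

Lemma cvg_complex_Re (z : nat -> R[i]) (l : R) :
  z n @[n --> \oo] --> (real_complex R l : R[i]^o) ->
  complex.Re (z n) @[n --> \oo] --> l.
Proof.
move=> /(@cvgrPdist_lt _ R[i]^o _ _ _ z) zl; apply/cvgrPdist_lt => e e0.
have e0' : 0 < real_complex R e by rewrite ltcR.
apply: filterS (zl _ e0') => n; rewrite -ltcR; apply: le_lt_trans.
apply: le_trans (normc_ge_Re _).
by rewrite raddfB.
Qed.

(** The quantity is half the square of [u n / sqrt (n + 1)], which is squeezed between 0 and the
    sequence of the hypothesis. *)
Lemma cvg_opnorm_sqr (u : nat -> R) : (forall n, 0 <= u n) ->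
  (ln n.+1%:R * u n / Num.sqrt n.+1%:R : R) @[n --> \oo] --> (0 : R) ->
  (u n ^+ 2 / (n.+1 + n.+1)%:R : R) @[n --> \oo] --> (0 : R).
Proof.
move=> u0 lu.
have us : (u n / Num.sqrt n.+1%:R : R) @[n --> \oo] --> (0 : R).
  apply: (@squeeze_cvgr _ _ _ _ (cst 0) (fun n => ln n.+1%:R * u n / Num.sqrt n.+1%:R)) => //; last first.
    exact: cvg_cst.
  near=> n; rewrite divr_ge0 ?sqrtr_ge0//= ler_wpM2r ?invr_ge0 ?sqrtr_ge0// ler_peMl//.
  (* [1 <= ln (n + 1)] as soon as [n] exceeds [expR 1]. *)
  rewrite -[leLHS]expRK ler_ln ?posrE ?expR_gt0// (@le_trans _ _ n%:R) ?ler_nat//.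
  by near: n; exact: nbhs_infty_ger.
have -> : (fun n => u n ^+ 2 / (n.+1 + n.+1)%:R) =
    (fun n => (u n / Num.sqrt n.+1%:R) * (u n / Num.sqrt n.+1%:R) * (1 / 2)).
  apply/funext => n; rewrite -expr2 exprMn exprVn sqr_sqrtr// natrD; field.
  by rewrite !nat1r -natrD !pnatr_eq0.
have := cvgM (cvgM us us) (@cvg_cst _ (1 / 2 : R) _ \oo _).
by rewrite !mul0r => c; exact: c.
Unshelve. all: by end_near. Qed.

Lemma cvg_inv_double : (2 / (n.+1 + n.+1)%:R : R) @[n --> \oo] --> (0 : R).
Proof.
have -> : (fun n => 2 / (n.+1 + n.+1)%:R : R) = @harmonic R.
  apply/funext => n; rewrite /harmonic/= natrD; field.
  by rewrite !nat1r -natrD !pnatr_eq0.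
exact: cvg_harmonic.
Qed.

End limits.

(* A n stands for the matrix A_(n+1), of size n + 1. *)
Theorem proposition8p4 (R : realType) (A : forall n, 'M[R[i]]_n.+1) (sigma : R)
  (hermA : forall n, A n \is hermsymmx)
  (trA : forall n, \tr (A n) = 0)
  (normA : (ln n.+1%:R * opnorm (A n) / Num.sqrt n.+1%:R : R) @[n --> \oo] --> (0 : R))
  (sigma_gt0 : 0 < sigma ^+ 2)
  (trA2 : (n.+1%:R^-1 * \tr (A n ^+ 2)) @[n --> \oo]
            --> (real_complex R (sigma ^+ 2) : R[i]^o)) :
  weak_cvg
    (fun n => numerical_measure (real_complex R (Num.sqrt n.+1%:R) *: A n))
    (normal_prob 0 sigma).
Proof.
have sigma0 : sigma != 0 by rewrite -sqrf_eq0 gt_eqF.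
have cvg_op := cvg_opnorm_sqr (fun n => opnorm_ge0 (A n)) normA.
pose a n := complex.Re (\tr (A n *m A n)) / n.+1%:R.
have cvg_a : a n @[n --> \oo] --> sigma ^+ 2.
  have -> : a = (fun n => complex.Re (n.+1%:R^-1 * \tr (A n ^+ 2))).
    apply/funext => n; rewrite /a expr2 mulrC.
    have -> : n.+1%:R^-1 = real_complex R n.+1%:R^-1 by rewrite fmorphV rmorph_nat.
    by case: (\tr _) => x y /=; rewrite mul0r subr0.
  exact: cvg_complex_Re trA2.
move=> h ch bh.
have [H hH] : exists H, forall x, `|h x| <= H.
  have [M [_ hM]] := bh; exists (M + 1) => x.
  by apply: (hM (M + 1)) => //; rewrite ltrDl.
have H0 : 0 <= H by rewrite (le_trans _ (hH 0)).
have int_h (P : probability (measurableTypeR R) R) :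
    (\int[P]_x (h x)%:E = (\int[P]_x h x)%:E)%E.
  rewrite fineK//; apply: integrable_fin_num => //.
  apply: (@le_integrable _ _ _ _ _ measurableT _ (EFin \o cst H)).
  - by apply/measurable_EFinP; exact: continuous_measurable_fun.
  - by move=> x _; rewrite lee_fin (le_trans (hH x))// ler_norm.
  - exact: finite_measure_integrable_cst.
rewrite int_h; under eq_fun do rewrite int_h.
apply: cvg_EFin; first exact: nearW.
have [f [f' [df cf' [L f'L] stein]]] := stein_solution sigma0 ch hH.
have L0 : 0 <= L by rewrite (le_trans _ (f'L 0)).
apply/cvgrPdist_lt => e e0.
(* Chosen so that [e/4 * K = e/4 + 2 H sigma^2]; as [K <= K^2], the truncation error
   [2 H sigma^2 / K^2] is at most [e/4]. The summand 1 ensures [K >= 1]. *)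
pose K := 1 + 8 * H * sigma ^+ 2 / e.
have K1 : 1 <= K
  by rewrite lerDl; apply: divr_ge0; [apply: mulr_ge0; [exact: mulr_ge0|exact: ltW]|exact: ltW].
have K0 : 0 < K by rewrite (lt_le_trans _ K1).
have e4 : 0 < e / 4 by rewrite divr_gt0.
have [eta eta0 hsl] := slutsky_pointwise ch hH K0 e4.
(* Makes [L * eps] at most [e/4]; [L + 1] avoids a division by zero when [L = 0]. *)
pose eps := e / (4 * (L + 1)).
have eps0 : 0 < eps by rewrite divr_gt0 ?mulr_gt0// ltr_wpDl.
(* [K], [eta] and [eps] are fixed before [n] grows, so [b n] converges. Its limit is at most three
   quarters of [e]: one from the modulus of continuity, one from [K], one from [eps]. *)
pose b n := e / 4 + 2 * H * (a n / K ^+ 2 + 2 / (n.+1 + n.+1)%:R / eta ^+ 2) +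
  L * (`|sigma ^+ 2 - a n| + eps + 2 * (opnorm (A n) ^+ 2 / (n.+1 + n.+1)%:R * a n) / eps).
have cvg_b : b n @[n --> \oo] -->
    e / 4 + 2 * H * (sigma ^+ 2 / K ^+ 2 + 0 / eta ^+ 2) +
    L * (`|sigma ^+ 2 - sigma ^+ 2| + eps + 2 * (0 * sigma ^+ 2) / eps).
  have cst (x : R) : (fun _ : nat => x) n @[n --> \oo] --> x by exact: cvg_cst.
  apply: cvgD.
    apply: cvgD => //; apply: cvgM => //; apply: cvgD; first by apply: cvgM.
    by apply: cvgM => //; exact: cvg_inv_double.
  apply: cvgM => //; apply: cvgD; last first.
    by apply: cvgM => //; apply: cvgM => //; apply: cvgM.
  by apply: cvgD => //; apply: cvg_norm; apply: cvgB.
have lim_b : e / 4 + 2 * H * (sigma ^+ 2 / K ^+ 2 + 0 / eta ^+ 2) +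
    L * (`|sigma ^+ 2 - sigma ^+ 2| + eps + 2 * (0 * sigma ^+ 2) / eps) < e.
  rewrite !mul0r mulr0 mul0r !addr0 subrr normr0 add0r.
  have t1 : 2 * H * (sigma ^+ 2 / K ^+ 2) <= e / 4.
    have K2 : 0 < K ^+ 2 by rewrite exprn_gt0.
    rewrite mulrA ler_pdivrMr//; apply: (@le_trans _ _ (e / 4 * K)).
      have -> : e / 4 * K = e / 4 + 2 * H * sigma ^+ 2 by rewrite /K; field; rewrite gt_eqF.
      by rewrite lerDr; exact: ltW.
    by rewrite ler_pM2l// expr2 ler_peMr//; exact: ltW.
  have t2 : L * eps <= e / 4.
    have -> : e / 4 = (L + 1) * eps by rewrite /eps; field; rewrite gt_eqF// ltr_wpDl.
    by rewrite ler_pM2r// lerDl.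
  lra.
have b_lt : \forall n \near \oo, b n < e by exact: (cvgr_lt _ cvg_b _ lim_b).
apply: filterS b_lt => n; apply: le_lt_trans; rewrite distrC.
exact: (@numerical_measure_normal _ _ _ _ _ f f').
Qed.
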